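(* Let $k\ge 2$ and let $H$ be a graph on $k$ vertices with minimum degree at least $k-2$ (that is, the complement of $H$ is a matching). Then for every $\eta>0$ there is a constant $c=c(\eta,H)>0$ such that for all integers $n\ge k$ and all $p\in(0,1]$ with $p\ge n^{-2/(k-1)}$, $$\Pr\left(\xi_H\ge (1+\eta)\,\mathbf{E}\,\xi_H\right)\le \exp\left[-c\, f(k,n,p)\right],$$ where $\xi_H=\xi_H^{n,p}$ is the number of copies of $H$ in $G(n,p)$ and $f(k,n,p)=\min\{n^2p^{k-1}\log(1/p),\; n^kp^{\binom{k}{2}}\}$.
   Context: $G(n,p)$ is the Erdős–Rényi random graph on $n$ vertices in which each edge is present independently with probability $p$. A copy of $H$ in $G(n,p)$ is any (not necessarily induced) subgraph of $G(n,p)$ isomorphic to $H$. *)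

(* Defs.v *)
From HB Require Import structures.
From mathcomp Require Import all_boot all_order all_algebra.
From mathcomp Require Import reals sequences exp.

Set Implicit Arguments.
Unset Strict Implicit.
Unset Printing Implicit Defensive.

Import Order.TTheory GRing.Theory Num.Theory.
Local Open Scope ring_scope.

Record sgraph (T : finType) := SGraph {
  edges : {set {set T}};
  edges_card2 : [forall e in edges, #|e| == 2%N] }.

HB.instance Definition _ (T : finType) := [isSub for @edges T].
HB.instance Definition _ (T : finType) := [Finite of sgraph T by <:].

Definition adj (T : finType) (G : sgraph T) : rel T :=
  fun x y => [set x; y] \in edges G.

Definition degree (T : finType) (G : sgraph T) (x : T) : nat :=
  #|[set y | adj G x y]|.

(* A subgraph is a pair (vertex set, edge set).  Keeping the vertex set makes
   copies of a graph with isolated vertices distinct when only their vertices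
   differ. *)
Definition is_subgraph (T : finType) (S : {set T} * {set {set T}})
    (G : sgraph T) : bool :=
  (S.2 \subset edges G) && [forall e in S.2, e \subset S.1].

Definition isomorphic_to (U T : finType) (H : sgraph U)
    (S : {set T} * {set {set T}}) : bool :=
  [exists f : {ffun U -> T},
    [&& injectiveb f, f @: [set: U] == S.1
      & [forall x, forall y, adj H x y == ([set f x; f y] \in S.2)]]].

Definition copies (U T : finType) (H : sgraph U) (G : sgraph T) :
    {set {set T} * {set {set T}}} :=
  [set S | is_subgraph S G && isomorphic_to H S].

Section RandomGraphs.
Variable R : realType.

(* The law of G(n,p): a product of Bernoulli(p) weights over the pairs of
   vertices. *)
Definition Gnp (n : nat) (p : R) (G : sgraph 'I_n) : R :=
  \prod_(e : {set 'I_n} | #|e| == 2%N) (if e \in edges G then p else 1 - p).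

Definition Gnp_Pr (n : nat) (p : R) (A : pred (sgraph 'I_n)) : R :=
  \sum_(G : sgraph 'I_n | A G) Gnp p G.

Definition Gnp_E (n : nat) (p : R) (X : sgraph 'I_n -> R) : R :=
  \sum_(G : sgraph 'I_n) Gnp p G * X G.

Definition xi (k n : nat) (H : sgraph 'I_k) (G : sgraph 'I_n) : R :=
  #|copies H G|%:R.

Definition rate (k n : nat) (p : R) : R :=
  Num.min (n%:R ^+ 2 * p ^+ (k - 1) * ln (1 / p)) (n%:R ^+ k * p ^+ 'C(k, 2)).

End RandomGraphs.

Arguments xi {R k n} H G.

(* Main.v *)
Require Import Defs.
From HB Require Import structures.
From mathcomp Require Import all_boot all_order all_algebra.
From mathcomp Require Import reals sequences exp.
From mathcomp Require Import zify ring lra.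

Set Implicit Arguments.
Unset Strict Implicit.
Unset Printing Implicit Defensive.

Import Order.TTheory GRing.Theory Num.Theory.
Local Open Scope ring_scope.

(** The proof is a moment argument in the style of Harel, Mousset and Samotij.
    Let [Y] count the embeddings of [H] in [G = G(n,p)].  Call a set [U] of
    pairs a seed if conditioning on [U \subset G] raises the mean of [Y] above
    [(1 + eta / 2) E Y].  If [G] contains no seed with at most [e(H) l] edges,
    then expanding [Y ^ l] one factor at a time shows that the [l]-th moment of
    [Y] is at most [((1 + eta / 2) E Y) ^ l], so by Markov such graphs
    contribute at most [((1 + eta / 2) / (1 + eta)) ^ l].  We take [l] to be a
    small multiple of [f = n^2 p^(k-1) s], where
    [s = min (log (1/p), n^(k-2) p^(C(k,2)-(k-1)))].

    A seed [U] contains many copies of some nonempty [F \subset H], namely at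
    least [delta n^k p^e(F)] of them.  Weighting the edges of [F] by a
    fractional matching, Shearer's inequality bounds the number of copies of [F]
    in a graph with [O(n^2 p^(k-1) s)] edges; unless [F] is [K_k] or a spanning
    star, some such matching beats the uniform one by [1/(k-1)], which yields a
    spare factor [p] and rules [F] out.  Finally, seeds rich in [K_k] contain a
    subgraph of large minimum degree, and seeds rich in stars contain many
    edges meeting few vertices; in both cases the number of such subgraphs with
    [m >= c n^2 p^(k-1)] edges is at most [p^(-(1-eps) m)], and a union bound
    finishes the proof. *)

(** * The law of G(n,p) *)

Definition pairs (T : finType) : {set {set T}} := [set e : {set T} | #|e| == 2%N].

Lemma edges_pairs (T : finType) (G : sgraph T) : edges G \subset pairs T.
Proof.
apply/subsetP => e eG; rewrite inE.
by have /forall_inP := edges_card2 G; apply.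
Qed.

Lemma Gnp_ge0 (R : realType) (n : nat) (p : R) (G : sgraph 'I_n) :
  0 <= p -> p <= 1 -> 0 <= Gnp p G.
Proof.
move=> p0 p1; apply: prodr_ge0 => e _; case: ifP => // _; by rewrite subr_ge0.
Qed.

Lemma Gnp_sup (R : realType) (n : nat) (p : R) (U : {set {set 'I_n}}) :
  U \subset pairs 'I_n ->
  \sum_(G : sgraph 'I_n | U \subset edges G) Gnp p G = p ^+ #|U|.
Proof.
move=> Up.
(* Expanding the product of [a e + b e] gives one term per set [J] of selected [e]. As [b] vanishes
   on [U] and [a] off the pairs, only edge sets of graphs containing [U] survive, each with its
   weight. *)
pose a e : R := if e \in pairs 'I_n then p else 0.
pose b e : R := if e \in U then 0 else if e \in pairs 'I_n then 1 - p else 1.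
have -> : p ^+ #|U| = \prod_e (a e + b e).
  rewrite (bigID (mem U)) /= [X in _ * X]big1 ?mulr1 => [|e eU]; last first.
    by rewrite /a /b (negbTE eU); case: ifP => _; rewrite ?add0r // addrC subrK.
  rewrite -prodr_const; apply: eq_bigr => e eU.
  by rewrite /a /b eU (subsetP Up) // addr0.
rewrite bigA_distr.
rewrite (bigID (fun J : {set {set 'I_n}} => (J \subset pairs 'I_n) && (U \subset J))) /=.
rewrite [X in _ = _ + X]big1 ?addr0 => [|J]; last first.
  rewrite negb_and => /orP[] /subsetPn[e e1 e2].
    by rewrite (bigD1 e) //= e1 /a (negbTE e2) mul0r.
  by rewrite (bigD1 e) //= (negbTE e2) /b e1 mul0r.
have gP (J : {set {set 'I_n}}) : J \subset pairs 'I_n -> [forall e in J, #|e| == 2%N].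
  by move=> /subsetP Jp; apply/forall_inP => e /Jp; rewrite inE.
(* The empty graph is the default value of [insubd]; it is never taken on sets of pairs. *)
pose g0 := SGraph (gP set0 (sub0set _)).
rewrite (reindex_onto (@edges _) (insubd g0)) /=; last first.
  move=> J /andP[Jp _]; rewrite val_insubd /=; case: ifP => // /negP[].
  exact: (gP J Jp).
apply: eq_big => G.
  by rewrite valKd eqxx andbT edges_pairs.
move=> UG; rewrite /Gnp [RHS](bigID (fun e => e \in pairs 'I_n)) /=.
rewrite [X in _ = _ * X]big1 ?mulr1.
  rewrite (eq_bigl (fun e => e \in pairs 'I_n)); last by move=> e; rewrite inE.
  apply: eq_bigr => e ep; rewrite /a /b ep; case: ifP => // eG.
  by case: ifP => // eU; rewrite (subsetP UG) in eG.
move=> e ep; rewrite /a /b (negbTE ep); case: ifP => eG.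
  by rewrite (subsetP (edges_pairs G)) in ep.
by case: ifP => // eU; rewrite (subsetP Up) in ep.
Qed.

(** Union bound: by [Gnp_sup], a fixed [I] lies in the random graph with probability [p ^+ #|I|]. *)
Lemma Gnp_Pr_union (R : realType) (n : nat) (p : R) (A : pred (sgraph 'I_n))
    (FF : {set {set {set 'I_n}}}) :
  0 <= p -> p <= 1 -> {in FF, forall I : {set {set 'I_n}}, I \subset pairs 'I_n} ->
  (forall G, A G -> exists2 I, I \in FF & I \subset edges G) ->
  Gnp_Pr p A <= \sum_(I in FF) p ^+ #|I|.
Proof.
move=> p0 p1 FFp AF.
have -> : \sum_(I in FF) p ^+ #|I| =
   \sum_(G : sgraph 'I_n) \sum_(I in FF | I \subset edges G) Gnp p G.
  rewrite (exchange_big_dep (mem FF)) /=; last by move=> G I _ /andP[].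
  apply: eq_bigr => I IF; rewrite -Gnp_sup ?FFp //.
  by apply: eq_bigl => G; rewrite IF.
rewrite /Gnp_Pr big_mkcond /=; apply: ler_sum => G _.
case: ifP => [/AF [I IF IG]|_]; last by apply: sumr_ge0 => *; exact: Gnp_ge0.
rewrite (bigD1 I) /= ?IF ?IG // lerDl.
by apply: sumr_ge0 => *; exact: Gnp_ge0.
Qed.

(** * Embeddings and copies *)

Definition push (U T : finType) (f : {ffun U -> T}) (F : {set {set U}}) :
  {set {set T}} := [set f @: (e : {set U}) | e in F].

(** The maps are defined on all of [U], including vertices that [F] leaves isolated; hence the
    factor [n ^ k] in the thresholds for every subpattern of [H]. *)
Definition embs (U T : finType) (F : {set {set U}}) (I : {set {set T}}) :
  {set {ffun U -> T}} := [set f : {ffun U -> T} | injectiveb f & push f F \subset I].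

Lemma embsP (U T : finType) (F : {set {set U}}) (I : {set {set T}})
    (f : {ffun U -> T}) :
  reflect (injective f /\ {in F, forall e : {set U}, f @: e \in I})
          (f \in embs F I).
Proof.
rewrite inE; apply: (iffP andP) => [[/injectiveP fi FI]|[fi FI]]; split=> //.
- by move=> e eF; apply: (subsetP FI); apply: imset_f.
- exact/injectiveP.
- by apply/subsetP => _ /imsetP[e eF ->]; exact: FI.
Qed.

Lemma card_push (U T : finType) (f : {ffun U -> T}) (F : {set {set U}}) :
  injective f -> #|push f F| = #|F|.
Proof. by move=> fi; rewrite card_imset //; exact: imset_inj. Qed.

Lemma push_pairs (U T : finType) (f : {ffun U -> T}) (F : {set {set U}}) :
  injective f -> F \subset pairs U -> push f F \subset pairs T.
Proof.
move=> fi /subsetP Fp; apply/subsetP => _ /imsetP[e /Fp + ->].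
by rewrite !inE card_imset.
Qed.

Lemma imset_set2 (U T : finType) (f : U -> T) x y :
  f @: [set x; y] = [set f x; f y].
Proof. by rewrite imsetU1 imset_set1. Qed.

Definition copy_of (U T : finType) (H : sgraph U) (f : {ffun U -> T}) :
  {set T} * {set {set T}} := (f @: [set: U], push f (edges H)).

Lemma adj_push (U T : finType) (H : sgraph U) (f : {ffun U -> T}) x y :
  injective f -> adj H x y = ([set f x; f y] \in push f (edges H)).
Proof.
move=> fi; rewrite -imset_set2 /push mem_imset //; exact: imset_inj.
Qed.

(** Every edge of a copy lies inside its vertex set, so both ends have preimages under the
    isomorphism; this forces the edge set to be the pushed one. *)
Lemma copiesP (U T : finType) (H : sgraph U) (G : sgraph T) S :
  reflect (exists2 f, f \in embs (edges H) (edges G) & S = copy_of H f)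
          (S \in copies H G).
Proof.
rewrite inE; apply: (iffP andP).
  case: S => W E [/andP[/= EG /forall_inP EW]].
  case/existsP => f /and3P[/injectiveP fi /eqP fW /forallP fE].
  have -> : E = push f (edges H).
    apply/setP => e; apply/idP/idP.
      move=> eE; have := subsetP (edges_pairs G) _ (subsetP EG _ eE).
      rewrite inE => /cards2P[u [v [uv ee]]].
      have eW : e \subset f @: [set: U] by rewrite fW; exact: EW.
      move: eW; rewrite {1}ee subUset !sub1set => /andP[].
      case/imsetP => x _ xu /imsetP[y _ yv].
      have /forallP/(_ y)/eqP := fE x.
      by move=> h; move: h; rewrite (adj_push _ _ _ fi) -xu -yv -ee eE => ->.
    case/imsetP => e0 e0H ->.
    have := subsetP (edges_pairs H) _ e0H.
    rewrite inE => /cards2P[x [y [xy ee]]].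
    have /forallP/(_ y)/eqP := fE x.
    by rewrite /adj -ee e0H ee imset_set2.
  exists f; last by rewrite /copy_of fW.
  apply/embsP; split=> // e eH; apply: (subsetP EG).
  have := subsetP (edges_pairs H) _ eH.
  rewrite inE => /cards2P[x [y [xy ee]]].
  have /forallP/(_ y)/eqP := fE x.
  by rewrite /adj -ee eH ee imset_set2 => <-.
case=> f /embsP[fi fG] ->; split.
  rewrite /is_subgraph /=; apply/andP; split.
    by apply/subsetP => _ /imsetP[e eH ->]; exact: fG.
  by apply/forall_inP => _ /imsetP[e eH ->]; apply: imsetS; exact: subsetT.
apply/existsP; exists f; rewrite /= eqxx; apply/and3P; split=> //.
  exact/injectiveP.
by apply/forallP => x; apply/forallP => y; rewrite (adj_push H x y fi).
Qed.

(** The factor [a] is the number of automorphisms of [H]: embeddings with the same copy differ by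
    precomposition with one. It does not depend on [G], so it cancels when a count is compared with
    its mean. *)
Lemma card_embs_copies (U T : finType) (H : sgraph U) :
  exists2 a, (0 < a)%N &
    forall G : sgraph T, #|embs (edges H) (edges G)| = (a * #|copies H G|)%N.
Proof.
pose Aut := [set s : {ffun U -> U} | injectiveb s & push s (edges H) == edges H].
exists #|Aut|.
  apply/card_gt0P; exists [ffun x => x]; rewrite inE; apply/andP; split.
    by apply/injectiveP => x y; rewrite !ffunE.
  apply/eqP; rewrite -[RHS]imset_id; apply: eq_imset => e.
  by rewrite -[RHS]imset_id; apply: eq_imset => x; rewrite ffunE.
move=> G; rewrite -sum1_card (partition_big (copy_of H) (mem (copies H G))) /=.
  rewrite mulnC -sum_nat_const; apply: eq_bigr => S /copiesP[f fE ->].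
  have /embsP[fi fG] := fE.
  rewrite sum1dep_card.
  pose c (s : {ffun U -> U}) : {ffun U -> T} := [ffun x => f (s x)].
  have ci : injective c.
    by move=> s s' /ffunP e; apply/ffunP => x; have := e x; rewrite !ffunE => /fi.
  have pc s F : push (c s) F = push f (push s F).
    rewrite /push -imset_comp; apply: eq_imset => e /=.
    by rewrite -imset_comp; apply: eq_imset => x; rewrite ffunE.
  have pi : injective (push f) by apply: imset_inj; exact: imset_inj.
  rewrite -(card_imset (mem Aut) ci); apply: eq_card => g.
  apply/idP/imsetP.
    rewrite inE => /andP[/embsP[gi gG]] /eqP[eV eE].
    have gf x : exists y, g x == f y.
      have : g x \in f @: setT by rewrite -eV imset_f.
      by case/imsetP => y _ ->; exists y.
    have [s gs] : exists s, g = c s.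
      exists [ffun x => xchoose (gf x)].
      by apply/ffunP => x; rewrite !ffunE; apply/eqP/(xchooseP (gf x)).
    exists s => //; rewrite inE; apply/andP; split.
      apply/injectiveP => x y e; apply: gi.
      by rewrite gs !ffunE e.
    by apply/eqP; apply: pi; rewrite -pc -gs.
  case=> s; rewrite /Aut !inE => /andP[/injectiveP si /eqP sH] ->.
  apply/andP; split.
    apply/andP; split.
      by apply/injectiveP => x y; rewrite !ffunE => /fi/si.
    apply/subsetP => _ /imsetP[e eH ->].
    have : (c s) @: e \in push (c s) (edges H) by apply: imset_f.
    rewrite pc sH => /imsetP[e' /fG + ->]; exact.
  rewrite /copy_of pc sH; apply/eqP; congr pair.
  apply/setP => z; apply/imsetP/imsetP => -[x _ ->].
    by exists (s x); rewrite ?ffunE.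
  have [s' s's ss'] := injF_bij si.
  by exists (s' x); rewrite ?ffunE ?ss'.
by move=> f fE; apply/copiesP; exists f.
Qed.

(** * Moments and seeds *)

Definition injs (U T : finType) : {set {ffun U -> T}} :=
  [set f : {ffun U -> T} | injectiveb f].

(* The mean number of embeddings of [F] conditioned on [I] being present. *)
Definition cond_mean (R : realType) (U T : finType) (p : R)
    (F : {set {set U}}) (I : {set {set T}}) : R :=
  \sum_(f in injs U T) p ^+ #|push f F :\: I|.

Lemma cond_mean0 (R : realType) (U T : finType) (p : R) (F : {set {set U}}) :
  cond_mean p F (set0 : {set {set T}}) = (#|T| ^_ #|U|)%:R * p ^+ #|F|.
Proof.
rewrite /cond_mean -card_inj_ffuns mulr_natl -sumr_const.
apply: eq_bigr => f; rewrite inE => /injectiveP fi.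
by rewrite setD0 card_push.
Qed.

Lemma card_setU_setD (T : finType) (A B : {set T}) :
  #|A :|: B| = (#|A| + #|B :\: A|)%N.
Proof.
have := subset_leq_card (subsetIl B A).
by rewrite cardsU cardsD (setIC A B); lia.
Qed.

(* [Z] is the event that there is no small seed.  In the inductive step either
   [U] is such that no graph in [Z] contains it, or the mean of [Y] given [U] is
   at most [mu]; the latter is spent on one factor of [Y], and the embedding it
   selects is added to [U]. *)
Lemma moment_bound (R : realType) (k n : nat) (p mu : R)
    (F : {set {set 'I_k}}) (l : nat) (Z : pred (sgraph 'I_n)) :
  0 <= p -> p <= 1 -> 0 <= mu -> F \subset pairs 'I_k ->
  (forall (G : sgraph 'I_n) (U : {set {set 'I_n}}), Z G -> U \subset edges G ->
     (#|U| <= #|F| * l)%N -> cond_mean p F U <= mu) ->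
  forall j (U : {set {set 'I_n}}), U \subset pairs 'I_n ->
    (#|U| + #|F| * j <= #|F| * l)%N ->
    \sum_(G : sgraph 'I_n | Z G && (U \subset edges G))
        Gnp p G * #|embs F (edges G)|%:R ^+ j <= mu ^+ j * p ^+ #|U|.
Proof.
move=> p0 p1 mu0 Fp ZP; elim=> [|j IH] U Up Ul.
  rewrite expr0 mul1r -Gnp_sup // [leRHS](bigID Z) /=.
  under eq_bigr do rewrite expr0 mulr1.
  rewrite (eq_bigl _ _ (fun _ => andbC _ _)) lerDl.
  by apply: sumr_ge0 => *; exact: Gnp_ge0.
have [/existsP[G0 /andP[ZG0 UG0]]|noG] :=
    boolP [exists G : sgraph 'I_n, Z G && (U \subset edges G)]; last first.
  rewrite big_pred0 ?mulr_ge0 ?exprn_ge0 // => G; apply/negP => h.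
  by case/existsP: noG; exists G.
have Um : cond_mean p F U <= mu by apply: (ZP G0) => //; lia.
have -> : \sum_(G : sgraph 'I_n | Z G && (U \subset edges G))
    Gnp p G * #|embs F (edges G)|%:R ^+ j.+1 =
  \sum_(f in injs 'I_k 'I_n)
   \sum_(G : sgraph 'I_n | Z G && (U :|: push f F \subset edges G))
    Gnp p G * #|embs F (edges G)|%:R ^+ j.
  rewrite (exchange_big_dep (fun G => Z G && (U \subset edges G))) /=; last first.
    by move=> f G _; rewrite subUset => /and3P[-> ->].
  apply: eq_bigr => G /andP[ZG UG]; rewrite exprSr mulrA mulr_natr -sumr_const.
  by apply: eq_bigl => f; rewrite !inE ZG subUset UG.
apply: (@le_trans _ _ (\sum_(f in injs 'I_k 'I_n)
    mu ^+ j * (p ^+ #|U| * p ^+ #|push f F :\: U|))).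
  apply: ler_sum => f; rewrite inE => /injectiveP fi.
  have -> : p ^+ #|U| * p ^+ #|push f F :\: U| = p ^+ #|U :|: push f F|.
    by rewrite -exprD card_setU_setD.
  apply: IH.
    by rewrite subUset Up push_pairs.
  have := (leq_card_setU U (push f F)).1; move: Ul; rewrite card_push // mulnS.
  lia.
rewrite -mulr_sumr exprSr -mulrA ler_wpM2l ?exprn_ge0 //.
by rewrite -mulr_sumr mulrC ler_wpM2r ?exprn_ge0.
Qed.

(** Markov's inequality for the [l]-th moment, starting [moment_bound] from the empty set of
    revealed edges. *)
Lemma Pr_moment_bound (R : realType) (k n : nat) (p mu thr : R)
    (F : {set {set 'I_k}}) (l : nat) (Z : pred (sgraph 'I_n)) :
  0 <= p -> p <= 1 -> 0 <= mu -> 0 < thr -> F \subset pairs 'I_k ->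
  (forall (G : sgraph 'I_n) (U : {set {set 'I_n}}), Z G -> U \subset edges G ->
     (#|U| <= #|F| * l)%N -> cond_mean p F U <= mu) ->
  Gnp_Pr p (fun G => Z G && (thr <= #|embs F (edges G)|%:R)) <= (mu / thr) ^+ l.
Proof.
move=> p0 p1 mu0 thr0 Fp ZP.
have := moment_bound p0 p1 mu0 Fp ZP (U := set0) (j := l) (sub0set _).
rewrite cards0 expr0 mulr1 add0n leqnn => /(_ isT) H.
rewrite expr_div_n ler_pdivlMr ?exprn_gt0 //; apply: le_trans H.
rewrite /Gnp_Pr mulr_suml [leRHS](bigID (fun G => thr <= #|embs F (edges G)|%:R)) /=.
rewrite (eq_bigl (fun G : sgraph 'I_n => [&& Z G, set0 \subset edges G &
    thr <= #|embs F (edges G)|%:R])); last by move=> G; rewrite sub0set.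
rewrite [in leRHS](eq_bigl (fun G : sgraph 'I_n => [&& Z G, set0 \subset edges G &
    thr <= #|embs F (edges G)|%:R])); last by move=> G; rewrite andbA.
apply: ler_wpDr.
  by apply: sumr_ge0 => *; rewrite mulr_ge0 ?Gnp_ge0 // exprn_ge0.
apply: ler_sum => G /and3P[_ _ h].
by rewrite ler_wpM2l ?Gnp_ge0 // lerXn2r // nnegrE // ltW.
Qed.

(** Sort the injections by their trace, the set [F'] of edges of [F] they send into [I]; exactly
    [#|F| - #|F'|] edges then remain to be paid for. *)
Lemma cond_mean_le (R : realType) (U T : finType) (p : R)
    (F : {set {set U}}) (I : {set {set T}}) : 0 <= p ->
  cond_mean p F I <=
    \sum_(F' : {set {set U}} | F' \subset F) #|embs F' I|%:R * p ^+ (#|F| - #|F'|).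
Proof.
move=> p0; pose tr (f : {ffun U -> T}) := [set e in F | f @: (e : {set U}) \in I].
rewrite /cond_mean (partition_big tr (fun F' => F' \subset F)) /=; last first.
  by move=> f _; apply/subsetP => e; rewrite inE => /andP[].
apply: ler_sum => F' F'F; rewrite mulr_natl -sumr_const.
rewrite [leRHS](bigID (fun f => tr f == F')) /=.
apply: ler_wpDr; first by apply: sumr_ge0 => *; rewrite exprn_ge0.
rewrite le_eqVlt; apply/orP; left; apply/eqP; apply: eq_big => f.
  rewrite !inE; case: eqP => [<-|]; rewrite ?andbT ?andbF //.
  case: injectiveb => //=; symmetry; apply/subsetP => _ /imsetP[e + ->].
  by rewrite inE => /andP[].
rewrite inE => /andP[/injectiveP fi /eqP trf]; congr (_ ^+ _).
have -> : push f F :\: I = push f (F :\: F').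
  apply/setP => x; rewrite !inE; apply/andP/imsetP.
    case=> xI /imsetP[e eF xe]; exists e => //.
    by rewrite !inE -trf inE eF -xe (negbTE xI).
  case=> e; rewrite !inE -trf inE => /andP[+ eF] ->.
  by rewrite eF /= => ->; split=> //; apply: imset_f.
rewrite card_push // cardsD; congr (_ - _)%N.
by rewrite (setIidPr F'F).
Qed.

Lemma expn_le_ffact (n k j : nat) :
  (k <= n)%N -> (j <= k)%N -> (n ^ j <= k ^ j * n ^_ j)%N.
Proof.
move=> kn; elim: j => [|j IH] jk; first by rewrite !expn0 ffactn0.
rewrite !expnSr ffactnSr mulnACA leq_mul ?IH ?(ltnW jk) //.
nia.
Qed.

(** By contraposition in [cond_mean_le]: the empty pattern contributes at most the unconditioned
    mean, and if all other patterns are sparse their sum is at most [eta] times it. The factor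
    [k ^ k] passes from [n ^ k] to the falling factorial. *)
Lemma seed_dense (R : realType) (k n : nat) (p eta delta : R)
    (F : {set {set 'I_k}}) (U : {set {set 'I_n}}) :
  0 < p -> p <= 1 -> (k <= n)%N -> 0 <= delta ->
  delta * (k ^ k * #|{set {set 'I_k}}|)%:R <= eta ->
  (1 + eta) * cond_mean p F (set0 : {set {set 'I_n}}) < cond_mean p F U ->
  exists F' : {set {set 'I_k}}, [/\ F' \subset F, F' != set0 &
    delta * (n%:R ^+ k * p ^+ #|F'|) <= #|embs F' U|%:R].
Proof.
move=> p0 p1 kn d0 dle; rewrite ltNge => /negP big.
suff /existsP[F' /and3P[F1 F2 F3]] : [exists F' : {set {set 'I_k}}, [&& F' \subset F,
    F' != set0 & delta * (n%:R ^+ k * p ^+ #|F'|) <= #|embs F' U|%:R]].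
  by exists F'.
apply: contraT => /existsPn noF.
case: big; apply: le_trans (cond_mean_le _ _ (ltW p0)) _.
rewrite cond_mean0 !card_ord (bigD1 set0) ?sub0set //= cards0 subn0 mulrDl mul1r.
have pe m : 0 <= p ^+ m by rewrite exprn_ge0 // ltW.
apply: lerD.
  rewrite ler_wpM2r // ler_nat.
  rewrite -[X in (_ <= X ^_ _)%N]card_ord -[X in (_ <= _ ^_ X)%N]card_ord.
  rewrite -card_inj_ffuns; apply: subset_leq_card; apply/subsetP => f.
  by rewrite !inE => /andP[].
apply: (@le_trans _ _ (\sum_(F' : {set {set 'I_k}}) delta * n%:R ^+ k * p ^+ #|F|)).
  rewrite big_mkcond /=; apply: ler_sum => F' _; case: ifP => [/andP[F'F F'0]|_].
    have := noF F'; rewrite F'F F'0 /= -ltNge => /ltW h.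
    have -> : delta * n%:R ^+ k * p ^+ #|F| =
        delta * (n%:R ^+ k * p ^+ #|F'|) * p ^+ (#|F| - #|F'|).
      by rewrite -!mulrA -exprD subnKC ?subset_leq_card.
    exact: ler_wpM2r.
  by rewrite !mulr_ge0 ?pe ?exprn_ge0.
rewrite sumr_const -[leLHS]mulr_natr [leLHS]mulrAC [leRHS]mulrA ler_wpM2r //.
apply: (@le_trans _ _ (delta * (k ^ k * #|{set {set 'I_k}}|)%:R * (n ^_ k)%:R)).
  rewrite -!natrX -!mulrA ler_wpM2l // -!natrM ler_nat.
  by rewrite [leqRHS]mulnAC leq_mul // expn_le_ffact.
by rewrite ler_wpM2r.
Qed.

(** * Shearer's inequality *)

(** With [m] the weighted mean, apply [1 + x <= expR x] to each [u j / m - 1]; the exponents add up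
    to zero. *)
Lemma weighted_AGM (R : realType) (J : finType) (P : pred J) (w : J -> nat)
    (D : nat) (u : J -> R) :
  (0 < D)%N -> (\sum_(j | P j) w j = D)%N -> (forall j, 0 <= u j) ->
  \prod_(j | P j) u j ^+ w j <= ((\sum_(j | P j) (w j)%:R * u j) / D%:R) ^+ D.
Proof.
move=> D0 wD u0; move mE : (_ / D%:R) => m.
have Dr : 0 < D%:R :> R by rewrite ltr0n.
have m0 : 0 <= m.
  by rewrite -mE divr_ge0 ?ler0n // sumr_ge0 // => j _; rewrite mulr_ge0.
(* If the mean is zero, some [u j] of positive weight vanishes, and with it the product. *)
have [mz|mN0] := eqVneq m 0.
  have [j Pj wj] : exists2 j, P j & (0 < w j)%N.
    apply/exists_inP; apply: contraLR D0; rewrite negb_exists_in => /forall_inP h.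
    by rewrite -wD big1 // => j /h; case: (w j).
  have uj : u j = 0.
    move: mz; rewrite -mE => /eqP; rewrite mulf_eq0 invr_eq0 (gt_eqF Dr) orbF psumr_eq0; last first.
      by move=> i _; rewrite mulr_ge0.
    move=> /allP/(_ j (mem_index_enum j)); rewrite Pj /= mulf_eq0 pnatr_eq0.
    by rewrite -leqn0 leqNgt wj /= => /eqP.
  rewrite (bigD1 j) //= uj expr0n -leqn0 leqNgt wj /= mul0r.
  exact: exprn_ge0.
have mp : 0 < m by rewrite lt_def mN0.
rewrite -[leRHS]mul1r -ler_pdivrMr ?exprn_gt0 // -{1}wD -prodrXr -prodf_div.
apply: (@le_trans _ _ (\prod_(j | P j) expR ((w j)%:R * (u j / m - 1)))).
  apply: ler_prod => j _; rewrite -expr_div_n exprn_ge0 ?divr_ge0 //=.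
  rewrite (mulrC (w j)%:R) expRM_natr lerXn2r ?nnegrE ?divr_ge0 ?expR_ge0 //.
  by have := expR_ge1Dx (u j / m - 1); set v := u j / m; lra.
rewrite -expR_sum.
have -> : \sum_(j | P j) (w j)%:R * (u j / m - 1) = 0; last by rewrite expR0.
under eq_bigr do rewrite mulrBr mulr1 mulrA.
rewrite sumrB -mulr_suml -natr_sum wD.
have -> : \sum_(j | P j) (w j)%:R * u j = m * D%:R by rewrite -mE divfK ?gt_eqF.
by rewrite mulrAC divff // mul1r subrr.
Qed.

(** Divide each [a j] by [C j], apply the arithmetic-geometric mean inequality at each [t], and sum.
    Indices outside [P] are simply bounded pointwise by [C j]. *)
Lemma weighted_holder (R : realType) (T J : finType) (P : pred J)
    (w : J -> nat) (D : nat) (C : J -> R) (a : J -> T -> R) (b : T -> R) :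
  (0 < D)%N -> (\sum_(j | P j) w j = D)%N -> (forall j, 0 < C j) ->
  (forall j t, 0 <= a j t) -> (forall t, 0 <= b t) ->
  (forall t, b t ^+ D <= \prod_j a j t ^+ w j) ->
  (forall j, P j -> \sum_t a j t <= C j) ->
  (forall j t, ~~ P j -> a j t <= C j) ->
  (\sum_t b t) ^+ D <= \prod_j C j ^+ w j.
Proof.
move=> D0 wD C0 a0 b0 bD aP aN.
have Dr : 0 < D%:R :> R by rewrite ltr0n.
set Q := \prod_j _.
have Q0 : 0 < Q by apply: prodr_gt0 => j _; rewrite exprn_gt0.
(* The [D]-th root of [Q], taken through the logarithm. *)
pose rho := expR (ln Q / D%:R).
have rhoD : rho ^+ D = Q by rewrite -expRM_natr divfK ?gt_eqF // lnK.
have rho0 : 0 < rho by exact: expR_gt0.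
have bt t : b t <= rho * ((\sum_(j | P j) (w j)%:R * (a j t / C j)) / D%:R).
  have s0 : 0 <= \sum_(j | P j) (w j)%:R * (a j t / C j).
    by apply: sumr_ge0 => j _; rewrite mulr_ge0 // divr_ge0 // ltW.
  rewrite -(ler_pXn2r D0) ?nnegrE //; last first.
    by rewrite mulr_ge0 ?divr_ge0 // ltW.
  apply: le_trans (bD t) _; rewrite exprMn rhoD.
  apply: (@le_trans _ _ (Q * \prod_(j | P j) (a j t / C j) ^+ w j)).
    rewrite /Q (bigID P) [in leRHS](bigID P) /= mulrAC ler_pM //.
    - by apply: prodr_ge0 => j _; rewrite exprn_ge0.
    - by apply: prodr_ge0 => j _; rewrite exprn_ge0.
    - rewrite -big_split /=; apply: ler_prod => j _; rewrite exprn_ge0 //=.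
      by rewrite -exprMn mulrCA divff ?mulr1 // gt_eqF.
    - apply: ler_prod => j Pj; rewrite exprn_ge0 //= lerXn2r ?nnegrE ?aN //.
      by rewrite ltW.
  rewrite ler_pM2l //; apply: weighted_AGM => // j.
  by rewrite divr_ge0 // ltW.
rewrite -rhoD lerXn2r ?nnegrE ?sumr_ge0 //; first exact: ltW.
apply: le_trans (ler_sum _ (fun t _ => bt t)) _.
rewrite -mulr_sumr -[leRHS]mulr1 ler_pM2l // -mulr_suml ler_pdivrMr // mul1r.
rewrite exchange_big /= -wD natr_sum; apply: ler_sum => j Pj.
rewrite -mulr_sumr -mulr_suml -[leRHS]mulr1 ler_wpM2l //.
by rewrite ler_pdivrMr ?mul1r ?aP.
Qed.

(** Filling the coordinates outside [S] with [None] keeps the projections for all [S] in one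
    type. *)
Definition proj (U T : finType) (S : {set U}) (f : {ffun U -> T}) :
  {ffun U -> option T} := [ffun i => if i \in S then Some (f i) else None].

(* Induction on the set [B] of free coordinates: slice [A] along one of them and
   recombine the slices with Hoelder's inequality. *)
Lemma shearer (R : realType) (U T : finType) (D : nat) (w : {set U} -> nat)
    (B : {set U}) (A : {set {ffun U -> T}}) :
  (0 < D)%N -> (forall i, i \in B -> \sum_(S : {set U} | i \in S) w S = D)%N ->
  {in A &, forall f g : {ffun U -> T}, {in ~: B, f =1 g}} ->
  #|A|%:R ^+ D <= \prod_(S : {set U}) #|proj S @: A|%:R ^+ w S :> R.
Proof.
move=> D0; move cB : #|B| => c; elim: c B cB A => [|c IH] B cB A wB AB.
  have {}cB := cards0_eq cB.
  have [->|A0] := eqVneq A set0.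
    by rewrite cards0 expr0n gtn_eqF // prodr_ge0 // => S _; rewrite exprn_ge0.
  have -> : #|A| = 1%N.
    case/set0Pn: A0 => f fA; apply/eqP/cards1P; exists f; apply/setP => g.
    rewrite inE; apply/idP/eqP => [gA|->//]; apply/ffunP => x.
    by apply: AB => //; rewrite cB !inE.
  rewrite expr1n -[leLHS]/(1 : R); elim/big_ind: _ => // [x y|S _].
    by move=> x1 y1; rewrite -[leLHS]mulr1 ler_pM.
  rewrite exprn_ege1 // ler1n card_gt0.
  case/set0Pn: A0 => f fA; apply/set0Pn; exists (proj S f); exact: imset_f.
have [A0|AN0] := eqVneq A set0.
  by rewrite A0 cards0 expr0n gtn_eqF // prodr_ge0 // => S _; rewrite exprn_ge0.
have [i iB] : exists i, i \in B by apply/set0Pn; rewrite -card_gt0 cB.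
pose At t := [set f in A | f i == t].
have -> : #|A|%:R = \sum_t #|At t|%:R :> R.
  rewrite -natr_sum -sum1_card (partition_big (fun f : {ffun U -> T} => f i) xpredT) //=.
  congr (_%:R); apply: eq_bigr => t _; rewrite sum1dep_card.
  by apply: eq_card => f; rewrite !inE.
(* For [S] containing [i] the projected slices are disjoint, so their sizes add up; for any other
   [S] each is at most the projection of [A]. *)
apply: (@weighted_holder R T _ (fun S : {set U} => i \in S) w D
   (fun S => #|proj S @: A|%:R) (fun S t => #|proj S @: At t|%:R)) => //.
- exact: wB.
- move=> S; rewrite ltr0n card_gt0.
  case/set0Pn: AN0 => f fA; apply/set0Pn; exists (proj S f); exact: imset_f.
- move=> t; apply: (IH (B :\ i)).
  + by move: cB; rewrite (cardsD1 i) iB add1n => -[].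
  + by move=> j; rewrite inE => /andP[_]; exact: wB.
  + move=> f g; rewrite !inE => /andP[fA /eqP fi] /andP[gA /eqP gi] x.
    rewrite !inE negb_and negbK => /orP[/eqP ->|xB]; first by rewrite fi gi.
    by apply: AB => //; rewrite inE.
- move=> S iS; rewrite -natr_sum ler_nat -sum1_card.
  apply: (@leq_trans (\sum_t \sum_(h in proj S @: A) (h i == Some t))).
    apply: leq_sum => t _; rewrite -sum1_card big_mkcond [leqRHS]big_mkcond /=.
    apply: leq_sum => h _; case: ifP => // /imsetP[f].
    rewrite inE => /andP[fA /eqP fi] ->.
    by rewrite imset_f // ffunE iS fi eqxx.
  rewrite exchange_big; apply: leq_sum => h _ /=.
  case: (h i) => [t|]; last by rewrite big1.
  rewrite (bigD1 t) //= eqxx big1 // => t' tt'.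
  by rewrite (inj_eq Some_inj) eq_sym (negbTE tt').
- move=> S t _; rewrite ler_nat; apply/subset_leq_card/imsetS.
  by apply/subsetP => f; rewrite inE => /andP[].
Qed.

Lemma pairsP (T : finType) (e : {set T}) :
  reflect (exists x y, x != y /\ e = [set x; y]) (e \in pairs T).
Proof. by rewrite inE; exact: cards2P. Qed.

Lemma in_pairs2 (T : finType) (x y : T) : ([set x; y] \in pairs T) = (x != y).
Proof. by rewrite inE cards2; case: (x != y). Qed.

Lemma set2_inj (T : finType) (x y z : T) :
  x != y -> [set x; y] = [set x; z] -> y = z.
Proof.
move=> xy e; have : y \in [set x; z] by rewrite -e !inE eqxx orbT.
by rewrite !inE eq_sym (negbTE xy) => /eqP.
Qed.

Lemma card_ordered_pairs (T : finType) (I : {set {set T}}) :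
  I \subset pairs T ->
  (#|[set xy : T * T | [set xy.1; xy.2] \in I]| <= 2 * #|I|)%N.
Proof.
move=> Ip; rewrite -sum1_card (partition_big (fun xy => [set xy.1; xy.2]) (mem I)) /=.
  rewrite mulnC -sum_nat_const; apply: leq_sum => e eI.
  have /pairsP[u [v [uv ->]]] := subsetP Ip _ eI.
  rewrite sum1dep_card; apply: (@leq_trans #|[set (u, v); (v, u)]|); last first.
    by rewrite cards2; case: (_ != _).
  apply/subset_leq_card/subsetP => -[x y]; rewrite !inE /= => /andP[_ /eqP e'].
  have xE : x \in [set u; v] by rewrite -e' !inE eqxx.
  have yE : y \in [set u; v] by rewrite -e' !inE eqxx orbT.
  have xy : x != y.
    by rewrite -in_pairs2 e' in_pairs2.
  move: xE yE xy; rewrite !inE !xpair_eqE.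
  by move=> /orP[] /eqP -> /orP[] /eqP ->; rewrite ?eqxx ?orbT.
by move=> [x y]; rewrite inE.
Qed.

Lemma card_proj1 (U T : finType) (i : U) (A : {set {ffun U -> T}}) :
  (#|proj [set i] @: A| <= #|T|)%N.
Proof.
pose h t := [ffun x : U => if x \in [set i] then Some t else None] : {ffun U -> option T}.
apply: leq_trans (leq_imset_card h T).
apply/subset_leq_card/subsetP => _ /imsetP[f _ ->].
apply/imsetP; exists (f i) => //; apply/ffunP => x; rewrite !ffunE inE.
by case: eqP => // ->.
Qed.

Lemma card_proj2 (U T : finType) (F : {set {set U}}) (I : {set {set T}}) e :
  F \subset pairs U -> I \subset pairs T -> e \in F ->
  (#|proj e @: embs F I| <= 2 * #|I|)%N.
Proof.
move=> Fp Ip eF; apply: leq_trans (card_ordered_pairs Ip).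
have /pairsP[a [b [ab ee]]] := subsetP Fp _ eF.
pose h (xy : T * T) := [ffun z : U => if z == a then Some xy.1 else
  if z == b then Some xy.2 else None] : {ffun U -> option T}.
apply: leq_trans (leq_imset_card h _).
apply/subset_leq_card/subsetP => _ /imsetP[f /embsP[fi fI] ->].
apply/imsetP; exists (f a, f b).
  by rewrite inE /= -imset_set2 -ee fI.
apply/ffunP => x; rewrite !ffunE ee !inE /=.
by case: eqP => [->//|_]; case: eqP => [->|].
Qed.

(** Complete [w] to an exact [D]-fold cover by giving the singleton of [i] the missing weight
    [D - d i], then apply [shearer]. Projections to an edge number at most [2 * #|I|], those to a
    singleton at most [#|T|]. *)
Lemma embs_le (R : realType) (U T : finType) (F : {set {set U}})
    (I : {set {set T}}) (w : {set U} -> nat) (D : nat) :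
  (0 < D)%N -> F \subset pairs U -> I \subset pairs T ->
  (forall e : {set U}, e \notin F -> w e = 0%N) ->
  (forall i : U, \sum_(e : {set U} | i \in e) w e <= D)%N ->
  #|embs F I|%:R ^+ D <= (2 * #|I|%:R) ^+ (\sum_e w e)
    * #|T|%:R ^+ (#|U| * D - 2 * \sum_e w e) :> R.
Proof.
move=> D0 Fp Ip wF wD; set W := (\sum_e w e)%N.
pose d i := (\sum_(e : {set U} | i \in e) w e)%N.
pose w1 (S : {set U}) := (\sum_i (S == [set i]) * (D - d i))%N.
pose w' (S : {set U}) := (w S + w1 S)%N.
have dW : (\sum_i d i = 2 * W)%N.
  rewrite /d (exchange_big_dep xpredT) //= /W big_distrr /=.
  apply: eq_bigr => e _; rewrite sum_nat_const.
  have [eF|/wF ->] := boolP (e \in F); last by rewrite !muln0.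
  by have := subsetP Fp _ eF; rewrite inE => /eqP ->.
have w'D i : (\sum_(S : {set U} | i \in S) w' S = D)%N.
  rewrite big_split /= -/(d i).
  suff -> : (\sum_(S : {set U} | i \in S) w1 S = D - d i)%N by rewrite subnKC ?wD.
  rewrite /w1 exchange_big /= (bigD1 i) //= [X in (_ + X)%N]big1 ?addn0.
    rewrite (bigD1 [set i]) ?inE //= eqxx mul1n big1 ?addn0 // => S /andP[_].
    by move=> /negbTE ->.
  move=> j ji; rewrite big1 // => S iS; case: eqP => //= Sj; move: iS.
  by rewrite Sj inE eq_sym (negbTE ji).
have -> : (#|U| * D - 2 * W = \sum_i (D - d i))%N.
  have := dW; have : (\sum_i (d i + (D - d i)) = #|U| * D)%N.
    by under eq_bigr do rewrite subnKC ?wD //; rewrite sum_nat_const.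
  by rewrite big_split /= => <- ->; rewrite addKn.
apply: le_trans (@shearer R U T D w' [set: U] _ D0 (fun i _ => w'D i) _) _.
  by move=> f g _ _ x; rewrite !inE.
rewrite (eq_bigr _ (fun S _ => exprD _ (w S) (w1 S))).
rewrite big_split /= ler_pM //; try by apply: prodr_ge0 => S _; rewrite exprn_ge0.
  rewrite /W -prodrXr; apply: ler_prod => e _; rewrite exprn_ge0 //=.
  have [eF|/wF ->] := boolP (e \in F); last by rewrite !expr0.
  by rewrite lerXn2r ?nnegrE ?mulr_ge0 // -natrM ler_nat card_proj2.
rewrite /w1; under eq_bigr do rewrite -prodrXr.
rewrite exchange_big /= -prodrXr; apply: ler_prod => i _; rewrite prodr_ge0 /=.
  rewrite (bigD1 [set i]) //= eqxx mul1n big1 ?mulr1.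
    by rewrite lerXn2r ?nnegrE // ler_nat card_proj1.
  by move=> S /negbTE ->; rewrite mul0n expr0.
by move=> S _; rewrite exprn_ge0.
Qed.

(** * Degrees and fractional matchings *)

Definition edeg (T : finType) (I : {set {set T}}) (u : T) : nat :=
  #|[set e : {set T} in I | u \in e]|.

Definition nbrs (T : finType) (I : {set {set T}}) (u : T) : {set T} :=
  [set x | (x != u) && ([set u; x] \in I)].

Definition star (T : finType) (a : T) : {set {set T}} :=
  [set e : {set T} in pairs T | a \in e].

Lemma edeg_nbrs (T : finType) (I : {set {set T}}) (u : T) :
  I \subset pairs T -> edeg I u = #|nbrs I u|.
Proof.
move=> Ip; rewrite /edeg.
have -> : [set e : {set T} in I | u \in e] = [set [set u; x] | x in nbrs I u].
  apply/setP => e; rewrite inE; apply/andP/imsetP => [[eI ue]|[x]].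
    have /pairsP[a [b [ab ee]]] := subsetP Ip _ eI.
    move: ue; rewrite ee !inE => /orP[] /eqP ->.
      by exists b => //; rewrite inE eq_sym ab -ee.
    by exists a; rewrite 1?setUC // inE ab setUC -ee.
  by rewrite inE => /andP[_ xI] ->; rewrite xI !inE eqxx.
rewrite card_in_imset // => x y; rewrite !inE => /andP[xu _] _.
by apply: set2_inj; rewrite eq_sym.
Qed.

Lemma nbrs_sub (T : finType) (I : {set {set T}}) (u : T) :
  nbrs I u \subset [set~ u].
Proof. by apply/subsetP => x; rewrite !inE => /andP[]. Qed.

Lemma edeg_lt (T : finType) (I : {set {set T}}) (u : T) :
  I \subset pairs T -> (edeg I u <= #|T|.-1)%N.
Proof.
move=> Ip; rewrite edeg_nbrs // -(cardsC1 u).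
exact/subset_leq_card/nbrs_sub.
Qed.

Lemma edeg_full (T : finType) (I : {set {set T}}) (u x : T) :
  I \subset pairs T -> edeg I u = #|T|.-1 -> x != u -> [set u; x] \in I.
Proof.
move=> Ip du xu; have : x \in nbrs I u; last by rewrite inE => /andP[].
have /eqP -> : nbrs I u == [set~ u].
  by rewrite eqEcard nbrs_sub cardsC1 -edeg_nbrs // du leqnn.
by rewrite !inE.
Qed.

Lemma edegE (T : finType) (I : {set {set T}}) (u : T) :
  edeg I u = (\sum_(e : {set T} | u \in e) (e \in I))%N.
Proof.
rewrite /edeg -sum1_card big_mkcond [RHS]big_mkcond /=; apply: eq_bigr => e _.
by rewrite inE; case: (u \in e); case: (e \in I).
Qed.

Lemma sum_edeg (T : finType) (I : {set {set T}}) :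
  I \subset pairs T -> (\sum_u edeg I u = 2 * #|I|)%N.
Proof.
move=> Ip; under eq_bigr do rewrite edegE.
rewrite (exchange_big_dep xpredT) //= -sum1_card big_distrr /= [RHS]big_mkcond.
apply: eq_bigr => e _; rewrite sum_nat_const; case: ifP => [eI|]; last by rewrite muln0.
by have := subsetP Ip _ eI; rewrite inE => /eqP ->.
Qed.

(** Bookkeeping at one vertex of an augmentation: [d] is the old weight, [r] the gain, [z] the loss,
    [a] the new weight and [P] the capacity. *)
Lemma gain_arith (a d P z r : nat) : (a + z = d + r -> d <= P ->
  r <= z \/ (r <= z.+1 /\ d < P) -> a <= P)%N.
Proof. lia. Qed.

(* [w / (#|U| - 1)] is a fractional matching.  Starting from [w = 1] on [F]: if an
   edge joins two vertices of degree less than [#|U| - 1], increase its weight.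
   Otherwise there are nonadjacent [b], [c] of smaller degree and dominating
   vertices [x], [y]; augment along the path [b - x - y - c]. *)
Lemma fractional_matching_gain (U : finType) (F : {set {set U}}) :
  F \subset pairs U -> F != set0 -> F != pairs U ->
  (forall a, F != star a) ->
  exists w : {set U} -> nat,
   [/\ forall e : {set U}, e \notin F -> w e = 0%N,
    forall i : U, (\sum_(e : {set U} | i \in e) w e <= #|U|.-1)%N &
    (\sum_e w e = #|F|.+1)%N].
Proof.
move=> Fp F0 Ff Fs.
have s1 (P : pred {set U}) (e0 : {set U}) : (\sum_(e | P e) (e == e0) = P e0)%N.
  rewrite big_mkcond (bigD1 e0) //= eqxx big1 ?addn0; first by case: (P e0).
  by move=> e /negbTE ->; case: (P e).
have FE : (\sum_e (e \in F) = #|F|)%N.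
  by rewrite -sum1_card [RHS]big_mkcond; apply: eq_bigr => e _; case: (e \in F).
have [/existsP[b /existsP[c /and3P[bcF db dc]]]|noU] := boolP [exists b, exists c,
   [&& [set b; c] \in F, (edeg F b < #|U|.-1)%N & (edeg F c < #|U|.-1)%N]].
  exists (fun e => (e \in F) + (e == [set b; c]))%N; split.
  - by move=> e /[dup] eF /negbTE ->; case: eqP => // ee; rewrite ee bcF in eF.
  - move=> i; rewrite big_split /= s1 -edegE.
    have := edeg_lt i Fp; rewrite !inE; case: eqP => [->|_] /=; first by rewrite addn1.
    by case: eqP => [->|_]; rewrite ?addn1 ?addn0.
  - by rewrite big_split /= s1 FE addn1.
(* In this case every edge has a dominating endpoint. *)
have sat b c : [set b; c] \in F -> edeg F b = #|U|.-1 \/ edeg F c = #|U|.-1.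
  move=> bcF; have := edeg_lt b Fp; have := edeg_lt c Fp.
  rewrite leq_eqVlt => /orP[/eqP|dc]; first by right.
  rewrite leq_eqVlt => /orP[/eqP|db]; first by left.
  case/negP: noU; apply/existsP; exists b; apply/existsP; exists c.
  by rewrite bcF db dc.
have [x dx] : exists x, edeg F x = #|U|.-1.
  case/set0Pn: F0 => e eF; have /pairsP[a [b [ab ee]]] := subsetP Fp _ eF.
  by rewrite ee in eF; case: (sat _ _ eF) => h; [exists a|exists b].
(* As [F] is not the star at [x], some edge avoids [x]; its dominating endpoint is [y]. *)
have [y yx dy] : exists2 y, y != x & edeg F y = #|U|.-1.
  have : exists2 e, e \in F & x \notin e.
    apply/exists_inP; apply: contraNT (Fs x); rewrite negb_exists_in.
    move=> /forall_inP h; rewrite eqEsubset; apply/andP; split.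
      apply/subsetP => e eF; rewrite inE (subsetP Fp) //=.
      by have := h _ eF; rewrite negbK.
    apply/subsetP => e; rewrite inE => /andP[/pairsP[a [b [ab ->]]]].
    rewrite !inE => /orP[] /eqP xe; first by rewrite -xe edeg_full // xe eq_sym.
    by rewrite setUC -xe edeg_full // xe.
  case=> e eF xe; have /pairsP[a [b [ab ee]]] := subsetP Fp _ eF.
  move: xe; rewrite ee in eF *; rewrite !inE negb_or => /andP[xa xb].
  by case: (sat _ _ eF) => h; [exists a|exists b] => //; rewrite eq_sym.
have [b [c [bc bcF]]] : exists b c, b != c /\ [set b; c] \notin F.
  have : exists2 e, e \in pairs U & e \notin F.
    by apply/subsetPn; apply: contraNN Ff => h; rewrite eqEsubset Fp.
  by case=> e /pairsP[b [c [bc ->]]] eF; exists b, c.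
have db : (edeg F b < #|U|.-1)%N.
  rewrite ltn_neqAle edeg_lt // andbT; apply: contraNN bcF => /eqP h.
  by rewrite edeg_full // eq_sym.
have dc : (edeg F c < #|U|.-1)%N.
  rewrite ltn_neqAle edeg_lt // andbT; apply: contraNN bcF => /eqP h.
  by rewrite setUC edeg_full.
have bx : b != x by apply: contraTneq db => ->; rewrite dx ltnn.
have by' : b != y by apply: contraTneq db => ->; rewrite dy ltnn.
have cx : c != x by apply: contraTneq dc => ->; rewrite dx ltnn.
have cy : c != y by apply: contraTneq dc => ->; rewrite dy ltnn.
have xyF : [set x; y] \in F by exact: edeg_full.
have xbF : [set x; b] \in F by exact: edeg_full.
have ycF : [set y; c] \in F by exact: edeg_full.
(* The edge [xy] drops to weight 0 while [xb] and [yc] rise to 2. The load at [x] and [y] is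
   unchanged, [b] and [c] use one unit of their slack, and the total grows by one. *)
pose w (e : {set U}) := if e == [set x; y] then 0%N else
  ((e \in F) + ((e == [set x; b]) + (e == [set y; c])))%N.
have wE (e : {set U}) : (w e + (e == [set x; y]) =
    (e \in F) + ((e == [set x; b]) + (e == [set y; c])))%N.
  rewrite /w; case: eqP => [->|_]; last by rewrite addn0.
  rewrite xyF; case: eqP => [/set2_inj e1|_].
    by have := by'; rewrite e1 ?eqxx // eq_sym.
  case: eqP => [|//]; rewrite [X in X = _]setUC => /set2_inj e1.
  by have := cx; rewrite e1 ?eqxx.
exists w; split.
- move=> e eF; rewrite /w (negbTE eF).
  by do 3 (case: eqP => [ee|_]; first by rewrite ee ?xyF ?xbF ?ycF in eF).
- move=> i; have := edeg_lt i Fp.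
  have : (\sum_(e : {set U} | i \in e) (w e + (e == [set x; y])) =
    edeg F i + ((i \in [set x; b]) + (i \in [set y; c])))%N.
    by under eq_bigr do rewrite wE; rewrite !big_split /= !s1 edegE.
  rewrite big_split /= s1 => h1 h2; apply: (gain_arith h1 h2); rewrite !inE.
  have [->|ix] := eqVneq i x.
    by left; rewrite (eq_sym x y) (negbTE yx) (eq_sym x c) (negbTE cx).
  have [->|iy] := eqVneq i y.
    by left; rewrite (eq_sym y b) (negbTE by') (eq_sym y c) (negbTE cy).
  have [->|ib] := eqVneq i b; first by right; rewrite (negbTE bc).
  by have [->|ic] := eqVneq i c; [right|left].
- have : (\sum_(e : {set U}) (w e + (e == [set x; y])) = #|F| + (1 + 1))%N.
    by under eq_bigr do rewrite wE; rewrite !big_split /= !s1 FE.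
  by rewrite big_split /= s1 addnA !addn1 => -[].
Qed.

(** * Union bounds *)

(** The binomial coefficient times [x ^+ m] is one term of [(1 + x) ^+ N], which is at most
    [expR (N * x)]. *)
Lemma bin_le_expR (R : realType) (N m : nat) (x : R) :
  0 < x -> 'C(N, m)%:R <= expR (N%:R * x) * x^-1 ^+ m.
Proof.
move=> x0; rewrite exprVn ler_pdivlMr ?exprn_gt0 //.
have [Nm|mN] := ltnP N m.
  by rewrite bin_small // mul0r expR_ge0.
rewrite expRM_natl; apply: (@le_trans _ _ ((x + 1) ^+ N)); last first.
  by rewrite lerXn2r ?nnegrE ?addr_ge0 ?expR_ge0 ?(ltW x0) // addrC expR_ge1Dx.
have mN' : (m < N.+1)%N by [].
rewrite exprD1n (bigD1 (Ordinal mN')) //= mulr_natl lerDl sumr_ge0 // => i _.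
by rewrite mulrn_wge0 // exprn_ge0 // ltW.
Qed.

Lemma card_bigcup_le (S E : finType) (A : S -> {set E}) :
  (#|\bigcup_g A g| <= \sum_g #|A g|)%N.
Proof.
elim/big_ind2: _ => [|n1 A1 n2 A2 h1 h2|//]; first by rewrite cards0.
exact: leq_trans (leq_card_setU A1 A2).1 (leq_add h1 h2).
Qed.

(** Choose a region [Rg g], then [m] of its at most [r] elements. The parameter [x] is free, to be
    tuned to the density of the sets in their region. *)
Lemma sum_covered_sets (R : realType) (S E : finType) (p x : R) (m r : nat)
    (Rg : S -> {set E}) (FF : {set {set E}}) :
  0 <= p -> 0 < x -> (forall g, #|Rg g| <= r)%N ->
  (forall I, I \in FF -> #|I| = m /\ exists g, I \subset Rg g) ->
  \sum_(I in FF) p ^+ #|I| <= #|S|%:R * (expR (r%:R * x) * (p / x) ^+ m).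
Proof.
move=> p0 x0 Rgr FFm.
rewrite (eq_bigr (fun=> p ^+ m)) => [|I /FFm[-> //]].
rewrite sumr_const -[leLHS]mulr_natl exprMn (mulrC (p ^+ m)) !mulrA.
rewrite ler_wpM2r ?exprn_ge0 //.
apply: (@le_trans _ _ (\sum_(g : S) expR (#|Rg g|%:R * x) * x^-1 ^+ m)).
  apply: (@le_trans _ _ (\sum_(g : S) 'C(#|Rg g|, m)%:R)); last first.
    by apply: ler_sum => g _; exact: bin_le_expR.
  rewrite -natr_sum ler_nat.
  apply: (@leq_trans #|\bigcup_(g : S) [set I : {set E} | I \subset Rg g & #|I| == m]|).
    apply/subset_leq_card/subsetP => I /FFm[Im [g Ig]].
    by apply/bigcupP; exists g => //; rewrite inE Ig Im eqxx.
  apply: leq_trans (card_bigcup_le _) _.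
  by apply: leq_sum => g _; rewrite cards_draws.
rewrite -mulr_suml; apply: ler_wpM2r; first by rewrite exprn_ge0 ?invr_ge0 ?ltW.
rewrite mulr_natl -sumr_const; apply: ler_sum => g _.
by rewrite ler_expR ler_pM2r // ler_nat.
Qed.

Lemma sum_half_le2 (R : realType) (N : nat) : \sum_(m < N) (2^-1 : R) ^+ m <= 2.
Proof.
suff : \sum_(m < N) (2^-1 : R) ^+ m = 2 - 2 * 2^-1 ^+ N.
  by move=> ->; rewrite gerBl mulr_ge0 ?exprn_ge0 ?invr_ge0 ?ler0n.
elim: N => [|N IH]; first by rewrite big_ord0 expr0 mulr1 subrr.
rewrite big_ord_recr /= IH exprS; lra.
Qed.

(** Split the bound for size [m] into two equal exponential factors: one is at most [2^-1 ^+ m]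
    because [a >= 2], the other is largest at [m0]. *)
Lemma sum_geometric_family (R : realType) (E : finType) (p a m0 : R)
    (FF : {set {set E}}) :
  0 <= p -> 0 <= m0 -> 2 <= a -> (forall I, I \in FF -> m0 <= #|I|%:R) ->
  (forall m, m0 <= m%:R ->
     \sum_(I in FF | #|I| == m) p ^+ #|I| <= expR (- a * m%:R)) ->
  \sum_(I in FF) p ^+ #|I| <= 2 * expR (- (a / 2) * m0).
Proof.
move=> p0 m00 a2 FF0 FFm; have h2 : 0 <= 2^-1 :> R by rewrite invr_ge0 ler0n.
rewrite (partition_big (fun I : {set E} => inord #|I| : 'I_#|E|.+1) xpredT) //=.
apply: (@le_trans _ _ (\sum_(m < #|E|.+1) 2^-1 ^+ m * expR (- (a / 2) * m0))).
  apply: ler_sum => m _.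
  rewrite (eq_bigl (fun I => (I \in FF) && (#|I| == m))); last first.
    move=> I; congr (_ && _); rewrite -val_eqE /= inordK // ltnS max_card //.
  have [mm|mm] := lerP m0 m%:R; last first.
    rewrite big_pred0 ?mulr_ge0 ?exprn_ge0 ?expR_ge0 // => I.
    apply/negP => /andP[/FF0 + /eqP Im]; rewrite Im; lra.
  apply: le_trans (FFm _ mm) _.
  have -> : - a * m%:R = - (a / 2) * m%:R + - (a / 2) * m%:R by lra.
  rewrite expRD ler_pM ?expR_ge0 //.
    rewrite expRM_natr lerXn2r ?nnegrE ?expR_ge0 // expRN lef_pV2 ?posrE ?expR_gt0 //.
    by have := expR_ge1Dx (a / 2); lra.
  rewrite ler_expR; nra.
by rewrite -mulr_suml ler_wpM2r ?expR_ge0 ?sum_half_le2.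
Qed.

(** * Dense subgraphs of seeds *)

(** Once [i] is sent to [u], the star forces all other vertices into the neighbourhood of [u]. *)
Lemma card_embs_at (U T : finType) (F : {set {set U}}) (I : {set {set T}})
    (i : U) (u : T) :
  I \subset pairs T -> star i \subset F ->
  (#|[set f : {ffun U -> T} in embs F I | f i == u]| <= edeg I u ^ #|U|.-1)%N.
Proof.
move=> Ip iF; rewrite edeg_nbrs //.
pose N (l : U) : {set T} := if l == i then [set u] else nbrs I u.
apply: (@leq_trans #|family (fun l => mem (N l))|).
  apply/subset_leq_card/subsetP => f; rewrite inE => /andP[/embsP[fi fI] /eqP fu].
  apply/familyP => l; rewrite /N; case: eqP => [->|/eqP li]; rewrite !inE ?fu //.
  rewrite -{1}fu (inj_eq fi) li -fu -imset_set2 fI // (subsetP iF) // inE.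
  by rewrite in_pairs2 eq_sym li !inE eqxx.
rewrite card_family foldrE big_image /= (bigD1 i) //= /N eqxx cards1 mul1n.
rewrite (eq_bigr (fun=> #|nbrs I u|)); last by move=> l /negbTE ->.
by rewrite prod_nat_const cardC1.
Qed.

Lemma card_embs_star (U T : finType) (I : {set {set T}}) (i : U) :
  I \subset pairs T ->
  (#|embs (star i) I| <= \sum_u edeg I u ^ #|U|.-1)%N.
Proof.
move=> Ip; rewrite -sum1_card (partition_big (fun f : {ffun U -> T} => f i) xpredT) //=.
apply: leq_sum => u _; rewrite sum1dep_card.
apply: leq_trans (card_embs_at u Ip (subxx (star i))).
by apply/subset_leq_card/subsetP => f; rewrite !inE.
Qed.

(* Take [J] maximising [#copies - Q #edges]: deleting all edges at [u] destroys
   at most [#|U| deg(u) ^ (#|U| - 1)] copies and gains [Q deg(u)]. *)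
Lemma clique_core (R : realType) (U T : finType) (I : {set {set T}}) (Q : R) :
  (2 <= #|U|)%N -> I \subset pairs T ->
  exists J : {set {set T}}, [/\ J \subset I,
    #|embs (pairs U) I|%:R - Q * #|I|%:R <= #|embs (pairs U) J|%:R - Q * #|J|%:R &
    forall u, (0 < edeg J u)%N -> Q <= #|U|%:R * (edeg J u)%:R ^+ (#|U| - 2)].
Proof.
move=> U2 Ip.
pose h (J : {set {set T}}) : R := #|embs (pairs U) J|%:R - Q * #|J|%:R.
case: (@arg_maxP _ _ _ I (fun J : {set {set T}} => J \subset I) h (subxx I)) => J JI Jmax.
exists J; split=> //; first exact: Jmax.
move=> u du; pose Ju := [set e : {set T} in J | u \in e].
have JuJ : Ju \subset J by apply/subsetP => e; rewrite inE => /andP[].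
have hJ : h (J :\: Ju) <= h J := Jmax (J :\: Ju) (subset_trans (subsetDl _ _) JI).
have cJ : #|J|%:R = #|J :\: Ju|%:R + (edeg J u)%:R :> R.
  rewrite -natrD cardsD (setIidPr JuJ) -/(edeg J u) subnK //.
  exact: subset_leq_card.
have cN : #|embs (pairs U) J|%:R <= #|embs (pairs U) (J :\: Ju)|%:R
    + #|U|%:R * (edeg J u)%:R ^+ #|U|.-1 :> R.
  rewrite -natrX -natrM -natrD ler_nat.
  (* Only embeddings using the vertex [u] are lost when its edges are deleted. *)
  pose B := \bigcup_(i : U) [set f : {ffun U -> T} in embs (pairs U) J | f i == u].
  apply: (@leq_trans #|embs (pairs U) (J :\: Ju) :|: B|).
    apply/subset_leq_card/subsetP => f fJ; rewrite inE.
    have [uf|/existsPn uf] := boolP [exists i, f i == u].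
      case/existsP: uf => i fi; apply/orP; right; apply/bigcupP; exists i => //.
      by rewrite inE fJ.
    apply/orP; left; have /embsP[fi fE] := fJ; apply/embsP; split=> // e eU.
    rewrite !inE fE // andbT; apply/negP => /andP[_ /imsetP[i _ ui]].
    by have := uf i; rewrite ui eqxx.
  apply: leq_trans (leq_card_setU _ _).1 _; rewrite leq_add2l.
  apply: leq_trans (card_bigcup_le _) _; rewrite -sum_nat_const.
  apply: leq_sum => i _; apply: card_embs_at; first exact: subset_trans JI Ip.
  by apply/subsetP => e; rewrite inE => /andP[].
have : Q * (edeg J u)%:R <= #|U|%:R * (edeg J u)%:R ^+ #|U|.-1 by move: hJ; rewrite /h cJ; lra.
have -> : #|U|.-1 = (#|U| - 2).+1 by lia.
by rewrite exprSr mulrA ler_pM2r // ltr0n.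
Qed.

Lemma card_pairs (T : finType) : #|pairs T| = 'C(#|T|, 2).
Proof. exact: card_draws. Qed.

Lemma sum_edeg_le (T : finType) (I : {set {set T}}) (P : pred T) :
  I \subset pairs T -> (\sum_(u | P u) edeg I u <= 2 * #|I|)%N.
Proof.
by move=> Ip; rewrite -sum_edeg // [leqRHS](bigID P) /= leq_addr.
Qed.

(** Encodes vertex sets of size at most [v] by functions, with repetitions allowed, so that there
    are at most [#|T| ^ v] to choose from. *)
Lemma enum_cover (T : finType) (W : {set T}) (v : nat) (x0 : T) :
  (#|W| <= v)%N -> exists g : {ffun 'I_v -> T}, forall x, x \in W -> exists i, g i = x.
Proof.
move=> Wv; exists [ffun i : 'I_v => nth x0 (enum W) i] => x xW.
have xs : (index x (enum W) < #|W|)%N by rewrite cardE index_mem mem_enum.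
exists (Ordinal (leq_trans xs Wv)); rewrite ffunE /= nth_index // mem_enum //.
Qed.

(** * Numerical estimates for counting cores *)

Lemma expr_le_expR (R : realType) (b y : R) (j : nat) :
  0 < b -> 0 <= y -> y ^+ j <= b ^+ j * expR (j%:R * y / b).
Proof.
move=> b0 y0; rewrite -mulrA expRM_natl -exprMn lerXn2r ?nnegrE ?mulr_ge0 ?expR_ge0 ?(ltW b0) //.
have := expR_ge1Dx (y / b); rewrite -ler_pdivrMl // mulrC; lra.
Qed.

(* Bounds the cost [ln n] of choosing a vertex of degree at least [d], with [n]
   standing for [ln n].  Near the threshold, [t] is comparable to [2 n / (k - 1)]
   and [d >= k] suffices; away from it, [L] is a power of [exp n]. *)
Lemma log_le_degree (R : realType) (k n t s K L d : R) :
  1 <= k -> 0 <= n -> 0 <= s -> s <= t -> 8 * (2 * k) <= K -> 16 * (2 * k) <= t ->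
  expR (n - (k - 1) * t / 2) <= L -> k <= d -> L <= d * (1 + s / K) ->
  2 * n <= (1 - (2 * k)^-1) * t * d.
Proof.
move=> k1 n0 s0 st Kk tk Ln kd Ld.
have kV : k * (2 * k)^-1 = 2^-1 by field; lra.
have [h|h] := lerP (2 * n) ((k - 2^-1) * t).
  have -> : (1 - (2 * k)^-1) * t * d = (k - 2^-1) * t + (1 - (2 * k)^-1) * t * (d - k).
    by rewrite -kV; ring.
  have : 0 <= (1 - (2 * k)^-1) * t * (d - k); last by lra.
  apply: mulr_ge0; last lra; apply: mulr_ge0; last lra.
  by rewrite subr_ge0 invf_le1; lra.
have v0 : 0 <= (2 * k)^-1 by rewrite invr_ge0; lra.
have v1 : (2 * k)^-1 <= 2^-1 by rewrite lef_pV2 ?posrE; lra.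
(* Now [t] is less than [2 * n / (k - 2^-1)], so the exponent [n - (k - 1) * t / 2] is at least
   [n / (2 * k - 1)]. *)
have nL : n <= (2 * k - 1) * L.
  have h1 := expR_ge1Dx (n - (k - 1) * t / 2).
  have : n <= (2 * k - 1) * (n - (k - 1) * t / 2); nra.
have sK : s / K <= t / (16 * k).
  rewrite ler_pdivrMr; last lra.
  rewrite mulrAC ler_pdivlMr; last lra.
  nra.
have d0 : 0 < d by lra.
have sK' : 2 * (2 * k - 1) * (s / K) <= t / 4.
  apply: le_trans (_ : 2 * (2 * k) * (t / (16 * k)) <= _); last first.
    by rewrite le_eqVlt; apply/orP; left; apply/eqP; field; lra.
  apply: ler_pM; [lra| |lra|exact: sK].
  by rewrite divr_ge0 //; lra.
apply: (@le_trans _ _ (t / 2 * d)); last by rewrite ler_wpM2r //; nra.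
apply: (@le_trans _ _ (2 * (2 * k - 1) * (1 + s / K) * d)); last first.
  by rewrite ler_wpM2r //; lra.
nra.
Qed.

(** Exponents per edge, in units of [t]: choosing vertices costs [1 - 1/(2k)], the exponential
    factor [1/(16k)], the inverse density [3/(16k)], and [p] gains 1. The balance is [- 1/(4k)]. *)
Lemma clique_level (R : realType) (n v m : nat) (k p t d M : R) :
  (0 < n)%N -> 1 <= k -> 0 < d -> 0 < M -> 16 * k <= t -> p = expR (- t) ->
  v%:R <= 2 * m%:R / d -> m%:R <= M ->
  2 * ln n%:R <= (1 - (2 * k)^-1) * t * d ->
  4 * M / d ^+ 2 <= expR (3 * t / (16 * k)) ->
  n%:R ^+ v * (expR ((v * v)%:R * (d ^+ 2 / (4 * M))) * (p / (d ^+ 2 / (4 * M))) ^+ m)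
    <= expR (- (t / (4 * k)) * m%:R).
Proof.
move=> n0 k1 d0 M0 tk pt vm mM nd Md.
have m0 : 0 <= m%:R :> R by [].
have v0 : 0 <= v%:R :> R by [].
have ln0 : 0 <= ln n%:R :> R by rewrite ln_ge0 // ler1n.
have vd : v%:R * d <= 2 * m%:R by rewrite -ler_pdivlMr.
have -> : - (t / (4 * k)) * m%:R = (1 - (2 * k)^-1) * t * m%:R + (m%:R * (t / (16 * k))
    + m%:R * (3 * t / (16 * k) - t)) by field; lra.
rewrite expRD (expRD (m%:R * _)) ler_pM ?mulr_ge0 ?exprn_ge0 ?expR_ge0 //.
- by rewrite divr_ge0 ?pt ?expR_ge0 // divr_ge0 ?exprn_ge0 ?mulr_ge0 // ltW.
- rewrite -[n%:R]lnK ?posrE ?ltr0n // -expRM_natl ler_expR.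
  apply: (@le_trans _ _ (2 * m%:R / d * ln n%:R)); first by rewrite ler_wpM2r.
  have -> : 2 * m%:R / d * ln n%:R = (2 * ln n%:R) * (m%:R / d) by field; lra.
  apply: (@le_trans _ _ ((1 - (2 * k)^-1) * t * d * (m%:R / d))).
    by rewrite ler_wpM2r ?divr_ge0 // ltW.
  by rewrite le_eqVlt; apply/orP; left; apply/eqP; field; lra.
rewrite ler_pM ?expR_ge0 ?exprn_ge0 //.
- by rewrite divr_ge0 ?pt ?expR_ge0 // divr_ge0 ?exprn_ge0 ?mulr_ge0 // ltW.
- rewrite ler_expR; apply: (@le_trans _ _ m%:R); last first.
    rewrite -[leLHS]mulr1 ler_wpM2l // ler_pdivlMr; lra.
  rewrite mulrA ler_pdivrMr ?mulr_gt0 // natrM -expr2 -exprMn.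
  apply: (@le_trans _ _ ((2 * m%:R) ^+ 2)).
    by rewrite lerXn2r // nnegrE mulr_ge0 // ltW.
  rewrite expr2; nra.
rewrite expRM_natl lerXn2r ?nnegrE ?expR_ge0 //.
  by rewrite divr_ge0 ?pt ?expR_ge0 // divr_ge0 ?exprn_ge0 ?mulr_ge0 // ltW.
rewrite addrC expRD -pt invf_div ler_wpM2l // pt; exact: expR_ge0.
Qed.

(** The left side is at most [4 * c * s ^+ 3], since [1 + s / K <= s]; the cube is absorbed by an
    exponential through [expr_le_expR]. *)
Lemma clique_codegree_le (R : realType) (k c s t K L d M : R) :
  0 < k -> 0 < c -> 4 * c * (16 * k) ^+ 3 <= 1 -> 2 <= s -> s <= t -> 2 <= K ->
  0 < L -> M = c * L ^+ 2 * s -> 0 < d -> L <= d * (1 + s / K) ->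
  4 * M / d ^+ 2 <= expR (3 * t / (16 * k)).
Proof.
move=> k0 c0 ck s2 st K2 L0 -> d0 Ld.
have sK : 1 + s / K <= s.
  have : s / K <= s / 2 by rewrite ler_pM2l ?lef_pV2 ?posrE; lra.
  lra.
have L2 : L ^+ 2 <= d ^+ 2 * s ^+ 2.
  rewrite -exprMn lerXn2r ?nnegrE ?mulr_ge0; try lra.
  by apply: le_trans Ld _; rewrite ler_pM2l.
apply: (@le_trans _ _ (4 * c * s ^+ 3)).
  rewrite ler_pdivrMr ?exprn_gt0 //.
  have -> : 4 * c * s ^+ 3 * d ^+ 2 = (4 * c * s) * (d ^+ 2 * s ^+ 2) by ring.
  have -> : 4 * (c * L ^+ 2 * s) = (4 * c * s) * L ^+ 2 by ring.
  by rewrite ler_pM2l // mulr_gt0; lra.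
have b0 : 0 < 16 * k by lra.
have h := @expr_le_expR R (16 * k) s 3 b0 ltac:(lra).
apply: le_trans (_ : 4 * c * ((16 * k) ^+ 3 * expR (3 * s / (16 * k))) <= _).
  by rewrite ler_pM2l //; lra.
rewrite mulrA -[leRHS]mul1r ler_pM ?expR_ge0 //.
  by rewrite !mulr_ge0 ?exprn_ge0 //; lra.
by rewrite ler_expR ler_pM2r ?invr_gt0 //; lra.
Qed.

(** * Clique seeds *)

Lemma double_bin2 (k : nat) : (2 * 'C(k, 2) = k * k.-1)%N.
Proof. by rewrite -mul_bin_diag bin1. Qed.

(** Weight one on every edge of the clique saturates all vertices, so no power of [#|T|] remains in
    [embs_le]. *)
Lemma clique_count (R : realType) (k : nat) (T : finType) (I : {set {set T}}) :
  (2 <= k)%N -> I \subset pairs T ->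
  #|embs (pairs 'I_k) I|%:R ^+ k.-1 <= (2 * #|I|%:R) ^+ 'C(k, 2) :> R.
Proof.
move=> k2 Ip; have D0 : (0 < k.-1)%N by lia.
have := @embs_le R 'I_k T (pairs 'I_k) I (fun e => e \in pairs 'I_k) k.-1 D0
  (subxx _) Ip.
have -> : (\sum_(e : {set 'I_k}) (e \in pairs 'I_k) = 'C(k, 2))%N.
  rewrite -[k in RHS]card_ord -card_pairs -sum1_card [RHS]big_mkcond /=.
  by apply: eq_bigr => e _; case: (e \in _).
rewrite card_ord double_bin2 subnn expr0 mulr1; apply.
  by move=> e /negbTE ->.
move=> i; rewrite -edegE -[k in leqRHS]card_ord.
exact: edeg_lt.
Qed.

(** Inverts [clique_count]. Both sides are raised to the power [2 * 'C(k, 2)] to avoid roots, and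
    [delta <= 1] absorbs the surplus powers of [delta]. *)
Lemma clique_size (R : realType) (k n : nat) (p delta : R) (I : {set {set 'I_n}}) :
  (2 <= k)%N -> (0 < n)%N -> 0 < p -> 0 < delta -> delta <= 1 ->
  I \subset pairs 'I_n ->
  delta * (n%:R ^+ k * p ^+ 'C(k, 2)) <= #|embs (pairs 'I_k) I|%:R ->
  delta * (n%:R ^+ 2 * p ^+ k.-1) <= 2 * #|I|%:R.
Proof.
move=> k2 n0 p0 d0 d1 Ip h.
have np : 0 < n%:R :> R by rewrite ltr0n.
have C0 : (0 < 2 * 'C(k, 2))%N by rewrite double_bin2 muln_gt0; lia.
have dC := double_bin2 k.
rewrite -(ler_pXn2r C0) ?nnegrE ?mulr_ge0 ?exprn_ge0 //; try exact: ltW.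
apply: (@le_trans _ _ ((delta * (n%:R ^+ k * p ^+ 'C(k, 2))) ^+ k.-1 ^+ 2)).
  rewrite -exprM (exprMn (2 * 'C(k, 2))%N) (exprMn (k.-1 * 2)%N) ler_pM //.
  - by rewrite exprn_ge0 // ltW.
  - by rewrite exprn_ge0 // mulr_ge0 ?exprn_ge0 // ltW.
  - by apply: ler_wiXn2l => //; [exact: ltW|rewrite dC mulnC leq_mul2r k2 orbT].
  rewrite !exprMn -!exprM le_eqVlt; apply/orP; left; apply/eqP.
  rewrite -exprD; congr (_ * _); congr (_ ^+ _); rewrite -?dC; nia.
have b0 : 0 <= delta * (n%:R ^+ k * p ^+ 'C(k, 2)).
  by rewrite mulr_ge0 ?mulr_ge0 ?exprn_ge0 // ltW.
have -> : (2 * #|I|%:R) ^+ (2 * 'C(k, 2)) = ((2 * #|I|%:R) ^+ 'C(k, 2)) ^+ 2 :> R.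
  by rewrite -exprM mulnC.
apply: lerXn2r.
- by rewrite nnegrE exprn_ge0.
- by rewrite nnegrE exprn_ge0 // mulr_ge0.
apply: le_trans (clique_count R k2 Ip).
by apply: lerXn2r; rewrite ?nnegrE.
Qed.

Lemma le_bin2_pred (k : nat) : (2 <= k)%N -> (k.-1 <= 'C(k, 2))%N.
Proof. by move=> k2; have := double_bin2 k; nia. Qed.

Lemma clique_mean_split (R : realType) (k n : nat) (p : R) : (2 <= k)%N ->
  n%:R ^+ k * p ^+ 'C(k, 2) =
  (n%:R ^+ 2 * p ^+ k.-1) * (n%:R ^+ (k - 2) * p ^+ ('C(k, 2) - k.-1)).
Proof.
by move=> k2; rewrite mulrACA -!exprD !subnKC // le_bin2_pred.
Qed.

(* The factor [n^(k-2) p^(C(k,2)-(k-1))] is [L^(k-2)] for [L^2 = n^2 p^(k-1)]. *)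
Lemma sqr_mean_ratio (R : realType) (k n : nat) (p : R) : (2 <= k)%N ->
  (n%:R ^+ (k - 2) * p ^+ ('C(k, 2) - k.-1)) ^+ 2 =
  (n%:R ^+ 2 * p ^+ k.-1) ^+ (k - 2).
Proof.
move=> k2; rewrite exprMn [in RHS]exprMn -!exprM (mulnC (k - 2)%N).
congr (_ * _ ^+ _).
have := double_bin2 k; nia.
Qed.

Lemma Pr_family_le (R : realType) (n : nat) (p a m0 : R)
    (A : pred (sgraph 'I_n)) (FF : {set {set {set 'I_n}}}) :
  0 <= p -> p <= 1 -> 0 <= m0 -> 2 <= a ->
  (forall I, I \in FF -> I \subset pairs 'I_n /\ m0 <= #|I|%:R) ->
  (forall G, A G -> exists2 I, I \in FF & I \subset edges G) ->
  (forall m, m0 <= m%:R ->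
     \sum_(I in FF | #|I| == m) p ^+ #|I| <= expR (- a * m%:R)) ->
  Gnp_Pr p A <= 2 * expR (- (a / 2) * m0).
Proof.
move=> p0 p1 m00 a2 FF0 AFF FFm.
apply: le_trans (Gnp_Pr_union p0 p1 _ AFF) _; first by move=> I /FF0[].
by apply: sum_geometric_family => // I /FF0[].
Qed.

Lemma half_deficit (R : realType) (delta x a b q1 q2 : R) :
  delta * x <= a -> a - q1 <= b - q2 -> q1 <= delta / 2 * x -> 0 <= q2 ->
  delta / 2 * x <= b.
Proof. lra. Qed.

Lemma clique_seeds (R : realType) (k n M : nat) (p c delta s : R) :
  (2 <= k)%N -> (0 < n)%N -> 0 < p -> p <= 1 -> 0 < delta -> delta <= 1 ->
  0 < c -> c * (1024 * 1024 * k%:R ^+ k) <= delta ->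
  s <= - ln p -> s <= n%:R ^+ (k - 2) * p ^+ ('C(k, 2) - k.-1) ->
  M%:R <= c * (n%:R ^+ 2 * p ^+ k.-1) * s ->
  Gnp_Pr p (fun G : sgraph 'I_n => [exists U : {set {set 'I_n}},
     [&& U \subset edges G, (#|U| <= M)%N &
         delta * (n%:R ^+ k * p ^+ 'C(k, 2)) <= #|embs (pairs 'I_k) U|%:R]])
  <= 2 * expR (- (delta / (32 * k%:R)) * (n%:R ^+ 2 * p ^+ k.-1 * - ln p)).
Proof.
move=> k2 n0 p0 p1 d0 d1 c0 cA.
set t := - ln p; set L2 := n%:R ^+ 2 * p ^+ k.-1; set Lam := n%:R ^+ (k - 2) * _.
move=> st sLam Ms.
have nr0 : 0 < n%:R :> R by rewrite ltr0n.
have kr2 : 2 <= k%:R :> R by rewrite ler_nat.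
have L20 : 0 < L2 by rewrite mulr_gt0 ?exprn_gt0.
have Lam0 : 0 < Lam by rewrite mulr_gt0 ?exprn_gt0.
have pt : p = expR (- t) by rewrite opprK lnK.
have mean : n%:R ^+ k * p ^+ 'C(k, 2) = L2 * Lam by exact: clique_mean_split.
have k0 : (0 < k)%N by exact: ltnW.
have k2k : k%:R ^+ 2 <= k%:R ^+ k :> R by rewrite -!natrX ler_nat leq_pexp2l.
have kkr : 4 <= k%:R ^+ k :> R by nra.
(* For small [s], [M] edges are too few for a seed by [clique_size], and the event is empty. *)
have [ssmall|sbig] := ltrP s (delta / (2 * c)).
  rewrite /Gnp_Pr big_pred0 ?mulr_ge0 ?expR_ge0 // => G.
  apply: negbTE; apply/existsPn => U; apply/negP => /and3P[UG UM].
  move/(clique_size k2 n0 p0 d0 d1 (subset_trans UG (edges_pairs G))); apply/negP.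
  rewrite -ltNge -/L2; apply: (@le_lt_trans _ _ (2 * (c * L2 * s))).
    by rewrite ler_pM2l //; apply: le_trans Ms; rewrite ler_nat.
  move: ssmall; rewrite ltr_pdivlMr; last lra.
  move=> h; rewrite -subr_gt0 (_ : _ - _ = L2 * (delta - s * (2 * c))); last by ring.
  by rewrite mulr_gt0 ?subr_gt0.
have skk : 512 * 1024 * k%:R ^+ k <= s.
  apply: le_trans sbig; rewrite ler_pdivlMr; last lra.
  by move: cA; set X := _ ^+ k; nra.
(* For [k = 2] the bound on [s] reads [s <= 1], against [s] being large. *)
have k3 : (3 <= k)%N.
  rewrite ltn_neqAle k2 andbT; apply: contraTneq sLam => kE.
  rewrite /Lam -kE subnn expr0 mul1r (_ : ('C(2, 2) - 2.-1)%N = 0%N) // expr0 -ltNge.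
  by rewrite -kE in skk; lra.
have k3k : k%:R ^+ 3 <= k%:R ^+ k :> R by rewrite -!natrX ler_nat leq_pexp2l.
(* Chosen so that [Q / k%:R = K * Lam / s] for the [Q] used below. *)
pose K := delta / (2 * k%:R * c).
have K_ge : 512 * 1024 * k%:R ^+ k.-1 <= K.
  rewrite ler_pdivlMr; last by rewrite !mulr_gt0 //; lra.
  move: cA; have -> : k%:R ^+ k = k%:R * k%:R ^+ k.-1 :> R.
    by rewrite -exprS prednK.
  by set X := _ ^+ k.-1; lra.
have kk1 : k%:R <= k%:R ^+ k.-1 :> R.
  by rewrite -natrX ler_nat -{1}(expn1 k) leq_pexp2l // -ltnS prednK.
have kk2 : k%:R ^+ (k - 2) <= k%:R ^+ k.-1 :> R.
  by rewrite -!natrX ler_nat leq_pexp2l // -subn1 leq_sub2l.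
have c3 : 4 * c * (16 * k%:R) ^+ 3 <= 1.
  have -> : 4 * c * (16 * k%:R) ^+ 3 = 1024 * 16 * (c * k%:R ^+ 3) by ring.
  have : c * k%:R ^+ 3 <= c * k%:R ^+ k by rewrite ler_pM2l.
  by move: cA; set X := c * _ ^+ 3; set Y := _ ^+ k; nra.
have sk : 16 * (2 * k%:R) <= s.
  by clear -skk k2k kr2; move: skk k2k; set X := _ ^+ k; nra.
have Kk : 8 * (2 * k%:R) <= K by clear -K_ge kk1 kr2; lra.
have Kk2 : k%:R ^+ (k - 2) <= K by clear -K_ge kk1 kk2 kr2; lra.
clear K_ge kk1 kk2 skk cA sbig k3k kkr k2k.
have L2E : L2 = n%:R ^+ 2 * p ^+ k.-1 by [].
have LamE : Lam = n%:R ^+ (k - 2) * p ^+ ('C(k, 2) - k.-1) by [].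
clearbody L2 Lam.
have s2 : 2 <= s by lra.
have s0 : 0 < s by lra.
have K2 : 2 <= K by lra.
have K0 : 0 < K by lra.
have t0 : 0 < t by lra.
have tk : 16 * (2 * k%:R) <= t by lra.
pose L := Num.sqrt L2.
have L0 : 0 < L by rewrite sqrtr_gt0.
have LL : L ^+ 2 = L2 by rewrite sqr_sqrtr // ltW.
have Lk : L ^+ (k - 2) = Lam.
  have Lp : 0 <= L ^+ (k - 2) by rewrite exprn_ge0 // ltW.
  apply/eqP; rewrite -(eqrXn2 (n := 2)) ?(ltW Lam0) //.
  by rewrite LamE sqr_mean_ratio // -L2E -LL -!exprM mulnC.
(* As [tau] is at most both 1 and [K / s], its power [k - 2] is at most [K / s]; it stands in for a
   root of [K / s]. *)
pose tau := (1 + s / K)^-1.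
have sK0 : 0 < s / K by rewrite divr_gt0.
have tau0 : 0 < tau by rewrite invr_gt0 addr_gt0.
have tau1 : tau <= 1 by rewrite invf_le1 ?addr_gt0 // lerDl ltW.
have tauK : tau <= K / s.
  by rewrite -[leRHS]invf_div lef_pV2 ?posrE ?addr_gt0 // lerDr.
pose d := Num.max k%:R (tau * L).
have d_k : k%:R <= d by rewrite le_max lexx.
have d_L : L <= d * (1 + s / K).
  rewrite -ler_pdivrMr ?addr_gt0 //.
  by rewrite mulrC le_max lexx orbT.
have d0' : 0 < d by apply: lt_le_trans d_k; rewrite ltr0n.
pose M' := c * L2 * s.
have M'0 : 0 < M' by rewrite mulr_gt0 // mulr_gt0.
pose FF := [set I : {set {set 'I_n}} | [&& I \subset pairs 'I_n,
  delta / 4 * L2 <= #|I|%:R, (#|I| <= M)%N &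
  [forall u, (0 < edeg I u)%N ==> (d <= (edeg I u)%:R)]]].
pose a := t / (4 * k%:R).
have k40 : 0 < 4 * k%:R :> R by rewrite mulr_gt0 // ltr0n.
have a2 : 2 <= a by rewrite ler_pdivlMr //; lra.
have -> : - (delta / (32 * k%:R)) * (L2 * t) = - (a / 2) * (delta / 4 * L2).
  by rewrite /a; field; rewrite pnatr_eq0 -lt0n.
apply: (@Pr_family_le R n p a (delta / 4 * L2) _ FF (ltW p0) p1) => //.
- by rewrite mulr_ge0 ?(ltW L20) // divr_ge0 // ltW.
- by move=> I; rewrite inE => /and4P[].
- move=> G /existsP[U /and3P[UG UM hU]].
  have Up := subset_trans UG (edges_pairs G).
  (* With this price per edge, all [M'] edges together cost half of the [delta * L2 * Lam] copies,
     so the core keeps the other half. *)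
  pose Q := delta * Lam / (2 * c * s).
  have k2' : (2 <= #|'I_k|)%N by rewrite card_ord.
  have [I [IU hI degI]] := @clique_core R 'I_k 'I_n U Q k2' Up.
  have Ip := subset_trans IU Up.
  have QM : Q * M' = delta / 2 * (L2 * Lam).
    by rewrite /Q /M'; field; rewrite ?gt_eqF.
  have Q0 : 0 <= Q by rewrite ltW // divr_gt0 // mulr_gt0 // mulr_gt0.
  have QU : Q * #|U|%:R <= delta / 2 * (L2 * Lam).
    by rewrite -QM ler_wpM2l // (le_trans _ Ms) // ler_nat.
  have QI : 0 <= Q * #|I|%:R by rewrite mulr_ge0.
  have dI : delta / 2 * (n%:R ^+ k * p ^+ 'C(k, 2)) <= #|embs (pairs 'I_k) I|%:R.
    by rewrite mean in hU *; exact: half_deficit hU hI QU QI.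
  have dI2 : delta / 2 * L2 <= 2 * #|I|%:R.
    rewrite L2E; apply: clique_size dI => //; first by rewrite divr_gt0.
    by rewrite ler_pdivrMr //; lra.
  exists I; last exact: subset_trans IU UG.
  rewrite inE Ip (leq_trans (subset_leq_card IU) UM) /=; apply/andP; split; first by lra.
  apply/forallP => u; apply/implyP => du; have := degI u du.
  rewrite card_ord => Qd.
  have kd : K * Lam / s <= (edeg I u)%:R ^+ (k - 2).
    have -> : K * Lam / s = Q / k%:R.
      by rewrite /K /Q; field; rewrite ?gt_eqF ?ltr0n.
    by rewrite ler_pdivrMr ?ltr0n // mulrC.
  have k20 : (0 < k - 2)%N by rewrite subn_gt0.
  rewrite ge_max; apply/andP; split.
    rewrite -(ler_pXn2r k20) ?nnegrE //.
    apply: le_trans Kk2 _; apply: le_trans kd.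
    by rewrite -mulrA -[leLHS]mulr1 ler_pM2l // ler_pdivlMr // mul1r.
  rewrite -(ler_pXn2r k20) ?nnegrE //; last by rewrite mulr_ge0 // ltW.
  apply: le_trans kd; rewrite exprMn Lk mulrAC ler_pM2r //.
  apply: le_trans tauK; rewrite -[leRHS]expr1.
  by apply: ler_wiXn2l => //; exact: ltW.
move=> m mm.
have [mM|mM] := lerP m%:R M'; last first.
  rewrite big_pred0 ?expR_ge0 // => I; apply/negP => /andP[].
  rewrite inE => /and4P[_ _ IM _] /eqP Im; move: mM; apply/negP; rewrite -leNgt.
  by apply: le_trans Ms; rewrite ler_nat -Im.
(* A core with [m] edges has at most [2 * m / d] vertices of positive degree, so its edges are pairs
   of values of some map [g] on ['I_v]. *)
pose v := Num.trunc (2 * m%:R / d).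
have vm : v%:R <= 2 * m%:R / d by rewrite truncn_le divr_ge0 ?mulr_ge0 ?(ltW d0').
pose Rg (g : {ffun 'I_v -> 'I_n}) := [set [set g ij.1; g ij.2] | ij : 'I_v * 'I_v].
have -> : \sum_(I in FF | #|I| == m) p ^+ #|I| =
   \sum_(I in [set I in FF | #|I| == m]) p ^+ #|I|.
  by apply: eq_bigl => I; rewrite !inE.
apply: le_trans (@sum_covered_sets R _ _ p (d ^+ 2 / (4 * M')) m (v * v) Rg _ _ _ _ _) _.
- exact: ltW.
- by rewrite divr_gt0 ?exprn_gt0 // mulr_gt0.
- by move=> g; apply: leq_trans (leq_imset_card _ _) _; rewrite card_prod card_ord.
- move=> I; rewrite inE => /andP[]; rewrite inE => /and4P[Ip _ _ /forallP Id] /eqP Im.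
  split=> //; pose W := [set u | (0 < edeg I u)%N].
  have Wv : (#|W| <= v)%N.
    rewrite truncn_ge_nat ?divr_ge0 ?mulr_ge0 ?(ltW d0') // ler_pdivlMr //.
    rewrite -Im -natrM -sum_edeg // natr_sum mulr_natl -sumr_const.
    rewrite [leRHS](bigID (mem W)) /=; apply: ler_wpDr; first exact: sumr_ge0.
    by apply: ler_sum => u; rewrite inE => uW; have := Id u; rewrite uW.
  have [g gW] := enum_cover (Ordinal n0) Wv.
  exists g; apply/subsetP => e eI; have /pairsP[x [y [xy ee]]] := subsetP Ip _ eI.
  have inW z : z \in e -> z \in W.
    by move=> ze; rewrite inE card_gt0; apply/set0Pn; exists e; rewrite inE eI.
  have [|i gi] := gW x; first by apply: inW; rewrite ee !inE eqxx.
  have [|j gj] := gW y; first by apply: inW; rewrite ee !inE eqxx orbT.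
  by apply/imsetP; exists (i, j) => //=; rewrite gi gj.
rewrite card_ffun !card_ord natrX /a.
apply: clique_level => //; try by lra.
- apply: (log_le_degree _ _ (ltW s0) st Kk tk _ d_k d_L); try by lra.
    by rewrite ln_ge0 // ler1n.
  (* In fact an equality: both sides square to [n ^ 2 * p ^ (k - 1)]. *)
  rewrite -(ler_pXn2r (n := 2)) ?nnegrE ?expR_ge0 ?(ltW L0) // LL L2E pt.
  rewrite -[n%:R in leRHS]lnK ?posrE // -!expRM_natl -expRD ler_expR.
  have -> : k.-1%:R = k%:R - 1 :> R by rewrite -subn1 natrB.
  by rewrite le_eqVlt; apply/orP; left; apply/eqP; field.
apply: (@clique_codegree_le R k%:R c s t K L d M') => //; first by rewrite ltr0n.
by rewrite LL.
Qed.

(** * Star seeds *)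

Lemma star_level (R : realType) (n v m : nat) (k p t theta : R) :
  (0 < n)%N -> 1 <= k -> 0 < theta -> 4 <= t -> p = expR (- t) ->
  v%:R <= 2 * m%:R / (theta * n%:R) ->
  2 * ln n%:R <= t / 4 * (theta * n%:R) -> 2 / theta <= expR (t / 4) ->
  n%:R ^+ v * (expR ((v * n)%:R * (theta / 2)) * (p / (theta / 2)) ^+ m)
    <= expR (- (t / (4 * k)) * m%:R).
Proof.
move=> n0 k1 th0 t4 pt vm lnt th.
have nr0 : 0 < n%:R :> R by rewrite ltr0n.
have m0 : 0 <= m%:R :> R by [].
have v0 : 0 <= v%:R :> R by [].
have ln0 : 0 <= ln n%:R :> R by rewrite ln_ge0 // ler1n.
have tn0 : 0 < theta * n%:R by rewrite mulr_gt0.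
have vd : v%:R * (theta * n%:R) <= 2 * m%:R by rewrite -ler_pdivlMr.
have x0 : 0 <= p / (theta / 2) by rewrite pt divr_ge0 ?expR_ge0 // divr_ge0 // ltW.
(* Per edge, choosing the centres costs [t / 4], the exponential factor 1 and the inverse density
   [t / 4], against a gain of [t] from [p]. *)
apply: (@le_trans _ _ (expR (t / 4 * m%:R + (m%:R + m%:R * (t / 4 - t))))).
  rewrite expRD (expRD m%:R) ler_pM ?mulr_ge0 ?exprn_ge0 ?expR_ge0 //.
    rewrite -[n%:R]lnK ?posrE // -expRM_natl ler_expR.
    apply: (@le_trans _ _ (2 * m%:R / (theta * n%:R) * ln n%:R)).
      by rewrite ler_wpM2r.
    rewrite mulrAC ler_pdivrMr //.
    by rewrite mulrAC mulrC [leRHS]mulrAC [leRHS]mulrC ler_wpM2l.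
  rewrite ler_pM ?expR_ge0 ?exprn_ge0 //.
    rewrite ler_expR natrM; lra.
  rewrite expRM_natl lerXn2r ?nnegrE ?expR_ge0 //.
  by rewrite addrC expRD -pt invf_div ler_wpM2l // pt; exact: expR_ge0.
rewrite ler_expR -subr_ge0.
have -> : - (t / (4 * k)) * m%:R - (t / 4 * m%:R + (m%:R + m%:R * (t / 4 - t))) =
   m%:R * (t / 2 - 1 - t / (4 * k)) by field; lra.
rewrite mulr_ge0 //.
have : t / (4 * k) <= t / 4; last by lra.
by rewrite ler_pM2l ?lef_pV2 ?posrE; lra.
Qed.

Lemma sum_edeg_expn_le (T : finType) (I : {set {set T}}) (P : pred T) (j : nat) :
  I \subset pairs T ->
  (\sum_(u | P u) edeg I u ^ j.+1 <= #|T| ^ j * \sum_(u | P u) edeg I u)%N.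
Proof.
move=> Ip; rewrite big_distrr /=; apply: leq_sum => u _.
rewrite expnSr leq_mul2r; apply/orP; right; case: j => [|j] //.
by rewrite leq_exp2r // (leq_trans (edeg_lt u Ip)) // leq_pred.
Qed.

Lemma card_star (k : nat) (i : 'I_k) : #|star i| = k.-1.
Proof.
have -> : #|star i| = edeg (pairs 'I_k) i by [].
rewrite edeg_nbrs // -[k in RHS]card_ord -(cardsC1 i); congr #|pred_of_set _|.
by apply/setP => x; rewrite !inE cards2 eq_sym; case: (i == x).
Qed.

Lemma star_seeds (R : realType) (k n M : nat) (p c delta s : R) (i : 'I_k) :
  (3 <= k)%N -> (0 < n)%N -> 0 < p -> p <= 1 -> 0 < delta -> delta <= 1 ->
  0 < c -> c * (1024 * 1024 * k%:R) <= delta ->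
  s <= - ln p -> M%:R <= c * (n%:R ^+ 2 * p ^+ k.-1) * s ->
  Gnp_Pr p (fun G : sgraph 'I_n => [exists U : {set {set 'I_n}},
     [&& U \subset edges G, (#|U| <= M)%N &
         delta * (n%:R ^+ k * p ^+ k.-1) <= #|embs (star i) U|%:R]])
  <= 2 * expR (- (delta / (32 * k%:R)) * (n%:R ^+ 2 * p ^+ k.-1 * - ln p)).
Proof.
move=> k3 n0 p0 p1 d0 d1 c0 cA.
set t := - ln p; set L2 := n%:R ^+ 2 * p ^+ k.-1 => st Ms.
have nr0 : 0 < n%:R :> R by rewrite ltr0n.
have k0 : (0 < k)%N by exact: leq_trans k3.
have kr3 : 3 <= k%:R :> R by rewrite ler_nat.
have L20 : 0 < L2 by rewrite mulr_gt0 ?exprn_gt0.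
have pt : p = expR (- t) by rewrite opprK lnK.
have k1E : k.-1 = (k - 2).+1 by rewrite -subn1 -subSn // ltnW.
have nk0 : 0 < n%:R ^+ (k - 2) :> R by rewrite exprn_gt0.
have mean : n%:R ^+ k * p ^+ k.-1 = n%:R ^+ (k - 2) * L2.
  by rewrite /L2 mulrA -exprD subnK // ltnW.
have starU (U : {set {set 'I_n}}) : U \subset pairs 'I_n ->
    #|embs (star i) U|%:R <= (\sum_u edeg U u ^ (k - 2).+1)%N%:R :> R.
  by move=> Up; rewrite ler_nat; have := card_embs_star i Up; rewrite card_ord k1E.
have sumP (U : {set {set 'I_n}}) (P : pred 'I_n) : U \subset pairs 'I_n ->
    (\sum_(u | P u) edeg U u ^ (k - 2).+1)%N%:R <=
    n%:R ^+ (k - 2) * (\sum_(u | P u) edeg U u)%N%:R :> R.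
  move=> Up; rewrite -natrX -natrM ler_nat.
  by have := sum_edeg_expn_le P (k - 2) Up; rewrite card_ord.
clearbody L2.
have [ssmall|sbig] := ltrP s (delta / (2 * c)).
  rewrite /Gnp_Pr big_pred0 ?mulr_ge0 ?expR_ge0 // => G.
  apply: negbTE; apply/existsPn => U; apply/negP => /and3P[UG UM]; apply/negP.
  have Up := subset_trans UG (edges_pairs G).
  rewrite -ltNge mean; apply: le_lt_trans (starU _ Up) _.
  apply: le_lt_trans (sumP _ _ Up) _; rewrite sum_edeg // natrM [ltRHS]mulrCA ltr_pM2l //.
  apply: (@le_lt_trans _ _ (2 * (c * L2 * s))).
    by rewrite ler_pM2l //; apply: le_trans Ms; rewrite ler_nat.
  move: ssmall; rewrite ltr_pdivlMr ?mulr_gt0 // => h.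
  have -> : 2 * (c * L2 * s) = L2 * (s * (2 * c)) by ring.
  by rewrite (mulrC delta) ltr_pM2l.
have skk : 512 * 1024 * k%:R <= s.
  apply: le_trans sbig; rewrite ler_pdivlMr ?mulr_gt0 //.
  by clear -cA; lra.
have sk : 16 * k%:R <= s by clear -skk kr3; lra.
have c8 : 8 * c / delta <= 4^-1.
  rewrite ler_pdivrMr //; clear -cA kr3 c0; nra.
clear skk cA.
have s2 : 2 <= s by clear -sk kr3; lra.
have s0 : 0 < s by clear -s2; lra.
have t16 : 16 * k%:R <= t by exact: le_trans st.
have t4 : 4 <= t by clear -t16 kr3; lra.
have t0 : 0 < t by clear -t4; lra.
(* Degree cutoff, as a fraction of [n]: vertices of degree below [theta * n] account for at most
   half of the stars required of a seed. *)
pose theta := delta / (4 * c * s).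
have th0 : 0 < theta by rewrite divr_gt0 // !mulr_gt0.
have th1 : theta <= 1.
  rewrite ler_pdivrMr ?mulr_gt0 // mul1r.
  by move: sbig; rewrite ler_pdivrMr ?mulr_gt0 // => h; clear -h d0; lra.
have thM : theta * (2 * (c * L2 * s)) = delta / 2 * L2.
  by rewrite /theta; field; rewrite ?gt_eqF.
have thV : 2 / theta = 8 * c / delta * s.
  by rewrite /theta; field; rewrite ?gt_eqF.
have thVt : 2 / theta <= t / 4.
  by rewrite thV mulrC ler_pM // ?(ltW s0) // divr_ge0 ?mulr_ge0 // ltW.
clearbody theta.
(* The candidates are edge sets covered by a set [B] of few vertices. *)
pose FF := [set I : {set {set 'I_n}} | [&& I \subset pairs 'I_n,
  delta / 4 * L2 <= #|I|%:R &
  [exists B : {set 'I_n}, (#|B|%:R * (theta * n%:R) <= 2 * #|I|%:R) &&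
     [forall e in I, exists u in B, u \in e]]]].
pose a := t / (4 * k%:R).
have k40 : 0 < 4 * k%:R :> R by rewrite mulr_gt0 // ltr0n.
have a2 : 2 <= a by rewrite ler_pdivlMr //; clear -t16 kr3; lra.
have -> : - (delta / (32 * k%:R)) * (L2 * t) = - (a / 2) * (delta / 4 * L2).
  by rewrite /a; field; rewrite pnatr_eq0 -lt0n.
apply: (@Pr_family_le R n p a (delta / 4 * L2) _ FF (ltW p0) p1) => //.
- by rewrite mulr_ge0 ?(ltW L20) // divr_ge0 // ltW.
- by move=> I; rewrite inE => /and3P[].
- move=> G /existsP[U /and3P[UG UM hU]].
  have Up := subset_trans UG (edges_pairs G).
  pose B := [set u | theta * n%:R <= (edeg U u)%:R].
  pose I := [set e in U | [exists u in B, u \in e]].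
  have IU : I \subset U by apply/subsetP => e; rewrite inE => /andP[].
  have Ip := subset_trans IU Up.
  have degI u : u \in B -> edeg U u = edeg I u.
    move=> uB; apply: eq_card => e; rewrite !inE.
    case: (e \in U) => //=; case ue: (u \in e); last by rewrite andbF.
    by rewrite andbT; symmetry; apply/exists_inP; exists u.
  have sumB : (\sum_(u in B) edeg U u <= 2 * #|I|)%N.
    by rewrite (eq_bigr _ degI) sum_edeg_le.
  have big : (\sum_(u in B) edeg U u ^ (k - 2).+1)%N%:R <=
      n%:R ^+ (k - 2) * (2 * #|I|%:R) :> R.
    apply: le_trans (sumP _ _ Up) _.
    by rewrite ler_pM2l // -natrM ler_nat.
  have k20 : (0 < k - 2)%N by rewrite subn_gt0.
  (* Below the cutoff, [k - 2] factors of the degree are at most [theta * n] each; as [k >= 3], at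
     least one factor [theta] is gained. *)
  have small : (\sum_(u | u \notin B) edeg U u ^ (k - 2).+1)%N%:R <=
      n%:R ^+ (k - 2) * (delta / 2 * L2).
    apply: (@le_trans _ _ (\sum_(u | u \notin B)
        theta * n%:R ^+ (k - 2) * (edeg U u)%:R)).
      rewrite natr_sum; apply: ler_sum => u; rewrite inE -ltNge => du.
      rewrite natrX exprSr ler_wpM2r //.
      apply: (@le_trans _ _ ((theta * n%:R) ^+ (k - 2))).
        by apply: lerXn2r; rewrite ?nnegrE // ltW // mulr_gt0.
      rewrite exprMn ler_pM2r // -[leRHS]expr1.
      by apply: ler_wiXn2l => //; exact: ltW.
    rewrite -mulr_sumr -natr_sum mulrAC mulrC -thM ler_pM2l // ler_pM2l //.
    apply: (@le_trans _ _ (2 * #|U|)%:R).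
      by rewrite ler_nat; exact: (sum_edeg_le (fun u => u \notin B)).
    by rewrite natrM ler_pM2l //; apply: le_trans Ms; rewrite ler_nat.
  exists I; last exact: subset_trans IU UG.
  rewrite inE Ip /=; apply/andP; split.
    have : n%:R ^+ (k - 2) * (delta * L2) <=
        n%:R ^+ (k - 2) * (2 * #|I|%:R + delta / 2 * L2).
      rewrite mulrCA -mean; apply: le_trans hU _; apply: le_trans (starU _ Up) _.
      by rewrite (bigID (mem B)) /= natrD mulrDr lerD.
    by rewrite ler_pM2l // => h; clear -h; lra.
  apply/existsP; exists B; apply/andP; split.
    apply: (@le_trans _ _ (\sum_(u in B) edeg U u)%N%:R).
      by rewrite natr_sum mulr_natl -sumr_const; apply: ler_sum => u; rewrite inE.
    by rewrite -natrM ler_nat.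
  by apply/forall_inP => e; rewrite inE => /andP[].
move=> m mm.
have tn0 : 0 < theta * n%:R by rewrite mulr_gt0.
pose v := Num.trunc (2 * m%:R / (theta * n%:R)).
have vm : v%:R <= 2 * m%:R / (theta * n%:R).
  by rewrite truncn_le divr_ge0 ?mulr_ge0 // ltW.
pose Rg (g : {ffun 'I_v -> 'I_n}) := [set [set g ij.1; ij.2] | ij : 'I_v * 'I_n].
have -> : \sum_(I in FF | #|I| == m) p ^+ #|I| =
   \sum_(I in [set I in FF | #|I| == m]) p ^+ #|I|.
  by apply: eq_bigl => I; rewrite !inE.
apply: le_trans (@sum_covered_sets R _ _ p (theta / 2) m (v * n) Rg _ _ _ _ _) _.
- exact: ltW.
- by rewrite divr_gt0.
- by move=> g; apply: leq_trans (leq_imset_card _ _) _; rewrite card_prod !card_ord.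
- move=> I; rewrite inE => /andP[]; rewrite inE.
  move=> /and3P[Ip _ /existsP[B /andP[Bm /forall_inP IB]]] /eqP Im.
  split=> //; have Bv : (#|B| <= v)%N.
    by rewrite truncn_ge_nat ?divr_ge0 ?mulr_ge0 ?(ltW th0) // ler_pdivlMr // -Im.
  have [g gB] := enum_cover (Ordinal n0) Bv.
  exists g; apply/subsetP => e eI; have /pairsP[x [y [xy ee]]] := subsetP Ip _ eI.
  have /exists_inP[u uB ue] := IB e eI; have [j gj] := gB u uB.
  move: ue; rewrite ee !inE => /orP[] /eqP ue; apply/imsetP.
    by exists (j, y) => //=; rewrite gj ue.
  by exists (j, x) => //=; rewrite gj ue setUC.
rewrite card_ffun !card_ord natrX /a.
apply: star_level => //.
- by rewrite ler1n.
- have lnn : ln n%:R <= n%:R :> R.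
    have h := @expR_ge1Dx R (ln n%:R); move: h; rewrite lnK ?posrE // => h.
    by clear -h; lra.
  have -> : t / 4 * (theta * n%:R) = (t / 4 * theta) * n%:R by rewrite mulrA.
  apply: ler_pM => //; first by rewrite ln_ge0 // ler1n.
  by rewrite -ler_pdivrMr.
apply: le_trans thVt _; have := @expR_ge1Dx R (t / 4); clear; lra.
Qed.

(** * Seeds are rare *)

Lemma rearrange (R : comPzRingType) (a b c d e : R) :
  a * (b * (c * d)) * e = a * c * (b * e * d).
Proof. ring. Qed.

(** A weighting of total [#|F| + 1] in [embs_le] leaves a spare [p ^+ k.-1] against
    [(2 * c * s) ^+ #|F|.+1], which contradicts the smallness of [c]. *)
Lemma other_seeds (R : realType) (k n M : nat) (p c delta s : R)
    (F : {set {set 'I_k}}) (U : {set {set 'I_n}}) :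
  (2 <= k)%N -> (0 < n)%N -> 0 < p -> p <= 1 -> 0 < delta -> delta <= 1 ->
  0 < c -> c * (2 * k%:R ^+ 2) < delta ^+ k.-1 ->
  s <= - ln p -> M%:R <= c * (n%:R ^+ 2 * p ^+ k.-1) * s ->
  F \subset pairs 'I_k -> F != set0 -> F != pairs 'I_k -> (forall i, F != star i) ->
  U \subset pairs 'I_n -> (#|U| <= M)%N ->
  #|embs F U|%:R < delta * (n%:R ^+ k * p ^+ #|F|).
Proof.
move=> k2 n0 p0 p1 d0 d1 c0 cA st Ms Fp F0 Ff Fs Up UM.
have k0 : (0 < k)%N by exact: ltnW.
have nr0 : 0 < n%:R :> R by rewrite ltr0n.
have D0 : (0 < k.-1)%N by rewrite -ltnS prednK.
have [w [wF wd wS]] := fractional_matching_gain Fp F0 Ff Fs.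
rewrite card_ord in wd.
have := @embs_le R 'I_k 'I_n F U w k.-1 D0 Fp Up wF wd.
rewrite wS !card_ord; set f := #|F|.
have fC : (f.+1 <= 'C(k, 2))%N.
  by rewrite -[k in 'C(k, _)]card_ord -card_pairs proper_card // properEneq Ff Fp.
have fk : (2 * f.+1 <= k * k.-1)%N by rewrite -double_bin2 leq_mul2l fC orbT.
move=> h; rewrite ltNge; apply/negP => hN.
have x0 : 0 <= delta * (n%:R ^+ k * p ^+ f).
  by rewrite mulr_ge0 ?mulr_ge0 ?exprn_ge0 // ltW.
have b0 : 0 < n%:R ^+ (k * k.-1) * p ^+ (k.-1 * f) :> R.
  by rewrite mulr_gt0 ?exprn_gt0.
have U0 : 2 * #|U|%:R <= 2 * (c * (n%:R ^+ 2 * p ^+ k.-1) * s) :> R.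
  by rewrite ler_pM2l //; apply: le_trans Ms; rewrite ler_nat.
have s0 : 0 <= s.
  have : 0 <= c * (n%:R ^+ 2 * p ^+ k.-1) * s by apply: le_trans Ms.
  by rewrite pmulr_rge0 // mulr_gt0 // mulr_gt0 // exprn_gt0.
have : (delta * (n%:R ^+ k * p ^+ f)) ^+ k.-1 <=
    (2 * (c * (n%:R ^+ 2 * p ^+ k.-1) * s)) ^+ f.+1 * n%:R ^+ (k * k.-1 - 2 * f.+1).
  apply: le_trans (_ : #|embs F U|%:R ^+ k.-1 <= _).
    by apply: lerXn2r; rewrite ?nnegrE.
  apply: le_trans h _; rewrite ler_wpM2r ?exprn_ge0 //.
  apply: lerXn2r => //; first by rewrite nnegrE mulr_ge0.
  by rewrite nnegrE (le_trans _ U0) // mulr_ge0.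
have -> : (delta * (n%:R ^+ k * p ^+ f)) ^+ k.-1 =
    delta ^+ k.-1 * (n%:R ^+ (k * k.-1) * p ^+ (k.-1 * f)).
  by rewrite exprMn [X in _ * X]exprMn -!exprM (mulnC f).
have -> : (2 * (c * (n%:R ^+ 2 * p ^+ k.-1) * s)) ^+ f.+1 * n%:R ^+ (k * k.-1 - 2 * f.+1) =
  ((2 * c * s) ^+ f.+1 * p ^+ k.-1) * (n%:R ^+ (k * k.-1) * p ^+ (k.-1 * f)).
  have -> : 2 * (c * (n%:R ^+ 2 * p ^+ k.-1) * s) = 2 * c * s * (n%:R ^+ 2 * p ^+ k.-1).
    by ring.
  rewrite (exprMn f.+1 (2 * c * s)) (exprMn f.+1 (n%:R ^+ 2)) -!exprM (mulnS k.-1) exprD.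
  have -> : n%:R ^+ (k * k.-1) = n%:R ^+ (2 * f.+1) * n%:R ^+ (k * k.-1 - 2 * f.+1) :> R.
    by rewrite -exprD subnKC.
  exact: rearrange.
rewrite ler_pM2r //; apply/negP; rewrite -ltNge; apply: le_lt_trans (cA).
have pt : p = expR (- (- ln p)) by rewrite opprK lnK.
(* Since [s <= - ln p], one factor [p] beats the power of [s]. *)
have sp : s ^+ f.+1 * p <= f.+1%:R ^+ f.+1.
  have f0 : 0 < f.+1%:R :> R by rewrite ltr0n.
  have := @expr_le_expR R f.+1%:R s f.+1 f0 s0.
  rewrite mulrAC divff ?gt_eqF // mul1r => h1.
  rewrite {1}pt expRN ler_pdivrMr ?expR_gt0 //.
  by apply: le_trans h1 _; rewrite ler_pM2l ?exprn_gt0 // ler_expR.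
have pk : p ^+ k.-1 <= p.
  by rewrite -[leRHS]expr1; apply: ler_wiXn2l => //; exact: ltW.
apply: (@le_trans _ _ ((2 * c * f.+1%:R) ^+ f.+1)).
  rewrite exprMn [leRHS]exprMn -mulrA ler_wpM2l ?exprn_ge0 ?mulr_ge0 ?(ltW c0) //.
  by apply: le_trans sp; rewrite ler_wpM2l ?exprn_ge0.
have fk2 : f.+1%:R <= k%:R ^+ 2 :> R.
  rewrite -natrX ler_nat; apply: leq_trans fC _.
  by have := double_bin2 k; clear; nia.
have dk : delta ^+ k.-1 <= 1 by rewrite exprn_ile1 // ltW.
have y0 : 0 <= 2 * c * f.+1%:R by rewrite !mulr_ge0 ?(ltW c0).
have y1 : 2 * c * f.+1%:R <= c * (2 * k%:R ^+ 2).
  by rewrite (mulrC 2 c) -mulrA ler_pM2l // ler_pM2l.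
apply: le_trans (y1); rewrite -[leRHS]expr1; apply: ler_wiXn2l => //.
exact: le_trans y1 (ltW (lt_le_trans cA dk)).
Qed.

Lemma Gnp_Pr_le_sum (R : realType) (n : nat) (p : R) (J : finType)
    (A : pred (sgraph 'I_n)) (B : J -> pred (sgraph 'I_n)) :
  0 <= p -> p <= 1 -> (forall G, A G -> exists j, B j G) ->
  Gnp_Pr p A <= \sum_j Gnp_Pr p (B j).
Proof.
move=> p0 p1 AB; rewrite /Gnp_Pr.
under [leRHS]eq_bigr do rewrite big_mkcond.
rewrite exchange_big /= big_mkcond; apply: ler_sum => G _.
have pos j : 0 <= if B j G then Gnp p G else 0.
  by case: ifP => // _; exact: Gnp_ge0.
case: ifP => [/AB[j BG]|_]; last exact: sumr_ge0.
by rewrite (bigD1 j) //= BG lerDl sumr_ge0.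
Qed.

Lemma Gnp_Pr_leU (R : realType) (n : nat) (p : R)
    (A B C : pred (sgraph 'I_n)) :
  0 <= p -> p <= 1 -> (forall G, A G -> B G || C G) ->
  Gnp_Pr p A <= Gnp_Pr p B + Gnp_Pr p C.
Proof.
move=> p0 p1 AB.
have := @Gnp_Pr_le_sum R n p bool A (fun b => if b then B else C) p0 p1.
rewrite big_bool; apply=> G /AB /orP[]; by [exists true|exists false].
Qed.

Lemma seeds_rare (R : realType) (k n M : nat) (p c delta s : R)
    (F : {set {set 'I_k}}) :
  (2 <= k)%N -> (0 < n)%N -> 0 < p -> p <= 1 -> 0 < delta -> delta <= 1 ->
  0 < c -> c * (1024 * 1024 * k%:R ^+ k) <= delta ^+ k ->
  s <= - ln p -> s <= n%:R ^+ (k - 2) * p ^+ ('C(k, 2) - k.-1) ->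
  M%:R <= c * (n%:R ^+ 2 * p ^+ k.-1) * s -> F \subset pairs 'I_k ->
  Gnp_Pr p (fun G : sgraph 'I_n => [exists U : {set {set 'I_n}},
     [&& U \subset edges G, (#|U| <= M)%N &
      [exists F' : {set {set 'I_k}}, [&& F' \subset F, F' != set0 &
         delta * (n%:R ^+ k * p ^+ #|F'|) <= #|embs F' U|%:R]]]])
  <= 2 * k.+1%:R * expR (- (delta / (32 * k%:R)) * (n%:R ^+ 2 * p ^+ k.-1 * - ln p)).
Proof.
move=> k2 n0 p0 p1 d0 d1 c0 cA st sLam Ms Fp.
have k0 : (0 < k)%N by exact: ltnW.
have kr2 : 2 <= k%:R :> R by rewrite ler_nat.
have dk : delta ^+ k <= delta by rewrite -[leRHS]expr1; apply: ler_wiXn2l => //; exact: ltW.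
have dk1 : delta ^+ k <= delta ^+ k.-1.
  by apply: ler_wiXn2l => //; [exact: ltW|exact: leq_pred].
have k2k : k%:R ^+ 2 <= k%:R ^+ k :> R by rewrite -!natrX ler_nat leq_pexp2l.
have k1k : k%:R <= k%:R ^+ k :> R.
  by rewrite -natrX ler_nat -{1}(expn1 k) leq_pexp2l.
(* The hypothesis with [delta ^+ k] yields the smallness of [c] needed for cliques, stars and the
   remaining patterns. *)
have cA1 : c * (1024 * 1024 * k%:R ^+ k) <= delta by exact: le_trans dk.
have cA2 : c * (1024 * 1024 * k%:R) <= delta.
  by apply: le_trans cA1; rewrite ler_pM2l // ler_pM2l // mulr_gt0.
have cA3 : c * (2 * k%:R ^+ 2) < delta ^+ k.-1.
  apply: lt_le_trans dk1; apply: lt_le_trans cA; rewrite ltr_pM2l //.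
  apply: (@le_lt_trans _ _ (2 * k%:R ^+ k)); first by rewrite ler_pM2l.
  by rewrite ltr_pM2r ?exprn_gt0 ?ltr0n //; clear; lra.
set e := expR _.
(* [None] stands for the clique and [Some i] for the star at [i]. The guard [3 <= k] removes the
   case where the star is itself the clique. *)
pose B (j : option 'I_k) : pred (sgraph 'I_n) := match j with
  | None => fun G => [exists U : {set {set 'I_n}},
     [&& U \subset edges G, (#|U| <= M)%N &
         delta * (n%:R ^+ k * p ^+ 'C(k, 2)) <= #|embs (pairs 'I_k) U|%:R]]
  | Some i => fun G => (3 <= k)%N && [exists U : {set {set 'I_n}},
     [&& U \subset edges G, (#|U| <= M)%N &
         delta * (n%:R ^+ k * p ^+ k.-1) <= #|embs (star i) U|%:R]] end.
apply: (@le_trans _ _ (\sum_j Gnp_Pr p (B j))).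
  apply: Gnp_Pr_le_sum => //; first exact: ltW.
  move=> G /existsP[U /and3P[UG UM /existsP[F' /and3P[F'F F'0 dF']]]].
  have Up := subset_trans UG (edges_pairs G).
  have F'p := subset_trans F'F Fp.
  have [F'E|F'N] := eqVneq F' (pairs 'I_k).
    exists None; apply/existsP; exists U.
    by rewrite UG UM /=; rewrite F'E card_pairs card_ord in dF'.
  have [/existsP[i /eqP F'E]|/existsPn F's] := boolP [exists i, F' == star i].
    exists (Some i); apply/andP; split.
      rewrite ltn_neqAle k2 andbT; apply: contraNneq F'N => kE.
      by rewrite eqEcard F'p card_pairs card_ord F'E card_star -kE.
    apply/existsP; exists U.
    by rewrite UG UM /=; rewrite F'E card_star in dF'.
  have := other_seeds k2 n0 p0 p1 d0 d1 c0 cA3 st Ms F'p F'0 F'N F's Up UM.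
  by rewrite ltNge dF'.
apply: (@le_trans _ _ (\sum_(j : option 'I_k) 2 * e)); last first.
  by rewrite sumr_const card_option card_ord -[leLHS]mulr_natl mulrCA mulrA.
apply: ler_sum => -[i|] _; last exact: clique_seeds st sLam Ms.
have [k3|k3] := ltnP 2 k.
  apply: le_trans (star_seeds i k3 n0 p0 p1 d0 d1 c0 cA2 st Ms).
  rewrite /Gnp_Pr le_eqVlt; apply/orP; left; apply/eqP; apply: eq_bigl => G.
  by rewrite /B k3.
rewrite /Gnp_Pr big_pred0 ?mulr_ge0 ?expR_ge0 // => G.
by rewrite /B ltnNge k3.
Qed.

(** * From rare seeds to the upper tail *)

Lemma exp_tail_combine (R : realType) (alpha C c3 f P : R) :
  0 < alpha -> 1 <= C -> 0 < c3 ->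
  P <= expR (- alpha) -> P <= C * expR (- c3 * f) ->
  P <= expR (- (alpha * c3 / (alpha + ln C)) * f).
Proof.
move=> a0 C1 c30 P1 P2; have b0 : 0 <= ln C by rewrite ln_ge0.
have ab : 0 < alpha + ln C by lra.
(* For small [f] the constant bound suffices; past this threshold, part of the exponent pays for the
   prefactor [C]. *)
have [h|h] := lerP (c3 * f) (alpha + ln C).
  apply: le_trans P1 _; rewrite ler_expR mulNr lerN2.
  have -> : alpha * c3 / (alpha + ln C) * f = alpha * (c3 * f / (alpha + ln C)).
    by field; rewrite gt_eqF.
  by rewrite -[leRHS]mulr1 ler_pM2l // ler_pdivrMr // mul1r.
apply: le_trans P2 _; rewrite -[C]lnK ?posrE; last lra.
rewrite -expRD ler_expR lnK ?posrE; last lra.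
have -> : - c3 * f = - (alpha * c3 / (alpha + ln C)) * f - ln C * (c3 * f / (alpha + ln C)).
  by field; rewrite gt_eqF.
have : ln C * 1 <= ln C * (c3 * f / (alpha + ln C)); last by lra.
by rewrite ler_wpM2l // ler_pdivlMr // mul1r ltW.
Qed.

Lemma embs_mean (R : realType) (k n : nat) (p : R) (F : {set {set 'I_k}}) :
  F \subset pairs 'I_k ->
  \sum_(G : sgraph 'I_n) Gnp p G * #|embs F (edges G)|%:R =
    cond_mean p F (set0 : {set {set 'I_n}}).
Proof.
move=> Fp; transitivity (\sum_(G : sgraph 'I_n)
    \sum_(f in injs 'I_k 'I_n | push f F \subset edges G) Gnp p G).
  apply: eq_bigr => G _; rewrite mulr_natr -sumr_const.
  by apply: eq_bigl => f; rewrite !inE.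
rewrite (exchange_big_dep (mem (injs 'I_k 'I_n))) /=; last by move=> G f _ /andP[].
apply: eq_bigr => f; rewrite inE => fi; rewrite setD0 -Gnp_sup.
  by apply: eq_bigl => G; rewrite fi.
by apply: push_pairs => //; exact/injectiveP.
Qed.

Lemma Gnp_Pr_markov (R : realType) (k n : nat) (p thr : R) (F : {set {set 'I_k}}) :
  0 <= p -> p <= 1 -> 0 < thr -> F \subset pairs 'I_k ->
  Gnp_Pr p (fun G : sgraph 'I_n => thr <= #|embs F (edges G)|%:R)
    <= cond_mean p F (set0 : {set {set 'I_n}}) / thr.
Proof.
move=> p0 p1 thr0 Fp; rewrite ler_pdivlMr // mulr_suml -embs_mean //.
rewrite [leRHS](bigID (fun G : sgraph 'I_n => thr <= #|embs F (edges G)|%:R)) /=.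
apply: ler_wpDr; first by apply: sumr_ge0 => G _; rewrite mulr_ge0 ?Gnp_ge0.
by apply: ler_sum => G h; rewrite ler_wpM2l ?Gnp_ge0.
Qed.

Lemma rateE (R : realType) (k n : nat) (p : R) : (2 <= k)%N -> 0 < p ->
  rate k n p = (n%:R ^+ 2 * p ^+ k.-1) *
    Num.min (- ln p) (n%:R ^+ (k - 2) * p ^+ ('C(k, 2) - k.-1)).
Proof.
move=> k2 p0; rewrite /rate minr_pMr ?mulr_ge0 ?exprn_ge0 ?(ltW p0) //.
by rewrite -clique_mean_split // subn1 div1r lnV // posrE.
Qed.

Lemma embs_tail (R : realType) (k n : nat) (p eta delta c : R)
    (F : {set {set 'I_k}}) :
  (2 <= k)%N -> (k <= n)%N -> 0 < p -> p <= 1 -> 0 < eta ->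
  0 < delta -> delta <= 1 ->
  delta * (k ^ k * #|{set {set 'I_k}}|)%:R <= eta / 2 ->
  0 < c -> c * (1024 * 1024 * k%:R ^+ k) <= delta ^+ k -> F \subset pairs 'I_k ->
  Gnp_Pr p (fun G : sgraph 'I_n =>
     (1 + eta) * cond_mean p F (set0 : {set {set 'I_n}}) <= #|embs F (edges G)|%:R)
  <= ((1 + eta / 2) / (1 + eta))^-1 *
       expR (- (c / #|F|.+1%:R * - ln ((1 + eta / 2) / (1 + eta))) * rate k n p)
     + 2 * k.+1%:R * expR (- (delta / (32 * k%:R)) * rate k n p).
Proof.
move=> k2 kn p0 p1 eta0 d0 d1 dD c0 cA Fp; set r := (1 + eta / 2) / (1 + eta).
have n0 : (0 < n)%N by apply: leq_trans kn; exact: ltnW.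
have L20 : 0 < n%:R ^+ 2 * p ^+ k.-1 by rewrite mulr_gt0 ?exprn_gt0 ?ltr0n.
have Lam0 : 0 < n%:R ^+ (k - 2) * p ^+ ('C(k, 2) - k.-1).
  by rewrite mulr_gt0 ?exprn_gt0 ?ltr0n.
set f := rate k n p; set mu0 := cond_mean p F set0.
have := rateE n k2 p0; rewrite -/f; set s := Num.min _ _ => fE.
have st : s <= - ln p by rewrite ge_min lexx.
have sL : s <= n%:R ^+ (k - 2) * p ^+ ('C(k, 2) - k.-1) by rewrite ge_min lexx orbT.
have s0 : 0 <= s by rewrite le_min oppr_ge0 ln_le0 // ltW.
have f0 : 0 <= f by rewrite fE mulr_ge0 // ltW.
have fLt : f <= n%:R ^+ 2 * p ^+ k.-1 * - ln p by rewrite fE ler_pM2l.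
have mu00 : 0 < mu0.
  by rewrite /mu0 cond_mean0 !card_ord mulr_gt0 ?exprn_gt0 // ltr0n ffact_gt0.
have e0 : 0 < #|F|.+1%:R :> R by rewrite ltr0n.
have r0 : 0 < r by rewrite divr_gt0; lra.
have r1 : r <= 1 by rewrite ler_pdivrMr; lra.
(* The moment order. The successor keeps the denominator positive when [F] is empty, and still gives
   [#|F| * l <= c * f]. *)
pose l := Num.trunc (c * f / #|F|.+1%:R).
have cf0 : 0 <= c * f / #|F|.+1%:R.
  by rewrite divr_ge0 // mulr_ge0 // ltW.
have l1 : l%:R <= c * f / #|F|.+1%:R by rewrite truncn_le.
have l2 : c * f / #|F|.+1%:R <= l.+1%:R.
  by rewrite ltW // truncnS_gt.
pose M := (#|F| * l)%N.
have Ms : M%:R <= c * (n%:R ^+ 2 * p ^+ k.-1) * s.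
  rewrite -mulrA -fE /M natrM mulrC.
  apply: (@le_trans _ _ (l%:R * #|F|.+1%:R)).
    by rewrite ler_wpM2l // ler_nat.
  by rewrite -ler_pdivlMr.
pose bad (G : sgraph 'I_n) := [exists U : {set {set 'I_n}},
  [&& U \subset edges G, (#|U| <= M)%N & (1 + eta / 2) * mu0 < cond_mean p F U]].
apply: (@le_trans _ _ (Gnp_Pr p (fun G : sgraph 'I_n => ~~ bad G &&
    ((1 + eta) * mu0 <= #|embs F (edges G)|%:R)) + Gnp_Pr p bad)).
  apply: Gnp_Pr_leU => //; first exact: ltW.
  by move=> G ->; rewrite andbT; case: (bad G).
apply: lerD.
  have ZP (G : sgraph 'I_n) (U : {set {set 'I_n}}) : ~~ bad G -> U \subset edges G ->
     (#|U| <= #|F| * l)%N -> cond_mean p F U <= (1 + eta / 2) * mu0.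
    move=> /existsPn/(_ U) + UG Ul; rewrite UG Ul /=.
    by rewrite -leNgt.
  have h1 : 0 <= (1 + eta / 2) * mu0 by rewrite mulr_ge0 ?(ltW mu00) //; lra.
  have h2 : 0 < (1 + eta) * mu0 by rewrite mulr_gt0 //; lra.
  apply: le_trans (Pr_moment_bound (ltW p0) p1 h1 h2 Fp ZP) _.
  have -> : (1 + eta / 2) * mu0 / ((1 + eta) * mu0) = r.
    by rewrite invfM mulrACA divff ?gt_eqF // mulr1.
  (* The prefactor [r^-1] pays for rounding [l] down. *)
  rewrite mulrC -ler_pdivrMr ?invr_gt0 // invrK -exprSr.
  rewrite -[r in leLHS]lnK ?posrE // -expRM_natl ler_expR.
  have lnr : ln r <= 0 by exact: ln_le0.
  have -> : - (c / #|F|.+1%:R * - ln r) * f = (c * f / #|F|.+1%:R) * ln r.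
    by rewrite mulrN opprK mulrAC; congr (_ * _); rewrite mulrAC.
  by rewrite ler_wnM2r.
have n0' := n0; apply: le_trans (_ : 2 * k.+1%:R * expR (- (delta / (32 * k%:R)) *
    (n%:R ^+ 2 * p ^+ k.-1 * - ln p)) <= _); last first.
  rewrite ler_wpM2l ?mulr_ge0 // ler_expR !mulNr lerN2 ler_wpM2l //.
  by rewrite divr_ge0 ?mulr_ge0 // ltW.
apply: le_trans (seeds_rare k2 n0 p0 p1 d0 d1 c0 cA st sL Ms Fp).
rewrite /Gnp_Pr big_mkcond [leRHS]big_mkcond; apply: ler_sum => G _.
have [/existsP[U /and3P[UG UM hU]]|_] := boolP (bad G); last first.
  by case: ifP => // _; rewrite Gnp_ge0 // ltW.
have [F' [F'F F'0 F'd]] := seed_dense p0 p1 kn (ltW d0) dD hU.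
case: ifPn => // /existsPn/(_ U); rewrite UG UM /= => /existsPn/(_ F').
by rewrite F'F F'0 F'd.
Qed.

Theorem theorem1p1 (R : realType) (k : nat) (H : sgraph 'I_k)
    (hk : (2 <= k)%N) (hH : forall x : 'I_k, (k - 2 <= degree H x)%N)
    (eta : R) (heta : 0 < eta) :
  exists2 c : R, 0 < c &
    forall (n : nat) (p : R), (k <= n)%N -> 0 < p -> p <= 1 ->
      n%:R `^ (- (2 / (k - 1)%:R)) <= p ->
      Gnp_Pr p (fun G : sgraph 'I_n =>
                  (1 + eta) * Gnp_E p (fun G' : sgraph 'I_n => xi H G') <= xi H G)
        <= expR (- c * rate k n p).
Proof.
have k0 : (0 < k)%N by exact: ltnW.
have Fp := edges_pairs H; set F := edges H in Fp.
pose A0 : R := (k ^ k * #|{set {set 'I_k}}|)%:R.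
have A00 : 0 < A0.
  by rewrite ltr0n muln_gt0 expn_gt0 k0 /=; apply/card_gt0P; exists set0.
(* Makes [seed_dense] applicable with [eta / 2], the increase of the mean that defines a seed. *)
pose delta := Num.min 1 (eta / 2 / A0).
have d0 : 0 < delta by rewrite lt_min ltr01 !divr_gt0.
have d1 : delta <= 1 by rewrite ge_min lexx.
have dA : delta * A0 <= eta / 2 by rewrite -ler_pdivlMr // ge_min lexx orbT.
pose kk : R := 1024 * 1024 * k%:R ^+ k.
have kk0 : 0 < kk by rewrite !mulr_gt0 ?exprn_gt0 ?ltr0n.
pose c := delta ^+ k / kk.
have c0 : 0 < c by rewrite divr_gt0 ?exprn_gt0.
have cA : c * kk <= delta ^+ k by rewrite divfK ?gt_eqF.
pose r := (1 + eta / 2) / (1 + eta).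
have r0 : 0 < r by rewrite divr_gt0 ?addr_gt0 ?divr_gt0.
have r1 : r < 1 by rewrite ltr_pdivrMr ?addr_gt0 // mul1r; lra.
pose beta := c / #|F|.+1%:R * - ln r.
have beta0 : 0 < beta.
  apply: mulr_gt0; first by rewrite divr_gt0 // ltr0n.
  by rewrite oppr_gt0 ln_lt0 // r0.
pose gamma := delta / (32 * k%:R).
have gamma0 : 0 < gamma by rewrite divr_gt0 ?mulr_gt0 ?ltr0n.
pose c3 := Num.min beta gamma.
have c30 : 0 < c3 by rewrite lt_min beta0.
pose C := r^-1 + 2 * k.+1%:R.
have C1 : 1 <= C.
  by rewrite -[1]addr0 lerD ?mulr_ge0 // invf_ge1 // ltW.
(* Markov's inequality bounds the probability by the inverse of [1 + eta], that is
   [expR (- alpha)]. *)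
pose alpha := ln (1 + eta).
have alpha0 : 0 < alpha by rewrite ln_gt0 // ltrDl.
exists (alpha * c3 / (alpha + ln C)).
  by rewrite divr_gt0 ?mulr_gt0 // ltr_wpDr // ln_ge0.
move=> n p kn p0 p1 _.
have [a a0 aE] := card_embs_copies 'I_n H.
set mu0 := cond_mean p F (set0 : {set {set 'I_n}}).
have mu00 : 0 < mu0.
  by rewrite /mu0 cond_mean0 !card_ord mulr_gt0 ?exprn_gt0 // ltr0n ffact_gt0.
have aXi (G : sgraph 'I_n) : #|embs F (edges G)|%:R = a%:R * xi H G :> R.
  by rewrite /xi -natrM -aE.
(* The automorphism factor [a] cancels, so copies may be replaced by embeddings. *)
have -> : Gnp_Pr p (fun G : sgraph 'I_n =>
    (1 + eta) * Gnp_E p (fun G' : sgraph 'I_n => xi H G') <= xi H G) =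
  Gnp_Pr p (fun G : sgraph 'I_n => (1 + eta) * mu0 <= #|embs F (edges G)|%:R).
  rewrite /Gnp_Pr; apply: eq_bigl => G.
  rewrite aXi /mu0 -embs_mean //.
  under eq_bigr do rewrite aXi mulrCA.
  by rewrite -mulr_sumr mulrCA ler_pM2l // ltr0n.
apply: exp_tail_combine => //.
  have thr0 : 0 < (1 + eta) * mu0 by rewrite mulr_gt0 ?addr_gt0.
  apply: le_trans (Gnp_Pr_markov n (ltW p0) p1 thr0 Fp) _.
  rewrite -/mu0 expRN lnK ?posrE ?addr_gt0 // invfM mulrC divfK //.
  by rewrite gt_eqF.
apply: le_trans (embs_tail hk kn p0 p1 heta d0 d1 dA c0 cA Fp) _.
rewrite -/r -/beta -/gamma [leRHS]mulrDl.
have f0 : 0 <= rate k n p.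
  rewrite rateE // mulr_ge0 ?mulr_ge0 ?exprn_ge0 ?(ltW p0) //.
  by rewrite le_min oppr_ge0 ln_le0 // mulr_ge0 ?exprn_ge0 // ltW.
apply: lerD; rewrite ler_wpM2l ?mulr_ge0 ?invr_ge0 ?(ltW r0) // ler_expR !mulNr lerN2 ler_wpM2r //.
  by rewrite ge_min lexx.
by rewrite ge_min lexx orbT.
Qed.
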